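(* Let $\mathcal E$ be a Krull–Schmidt exact category with torsion pairs $(\mathcal A,\mathcal B)$ and $(\mathcal B,\mathcal C)$, where $\mathcal C=\{X\in\mathcal E\mid\operatorname{Hom}_{\mathcal E}(\mathcal B,X)=0\}$. Let $F:\mathcal E\to\mathcal B$ be the left adjoint of the inclusion. Assume that $\mathcal B$ is an abelian category whose exact structure is compatible with that of $\mathcal E$, and that $\operatorname{Ext}^1_{\mathcal E}(\mathcal B,A)$ is a finitely generated $\mathcal B$-module for any $A\in\mathcal A\cap\mathcal C$. Then: (a) For any $A\in\mathcal A\cap\mathcal C$ there exists a short exact sequence $0\to A\to C^A\to U^A\to0$ with $U^A\in\mathcal B$, $C^A\in\mathcal C$ and $\operatorname{Ext}^1_{\mathcal E}(\mathcal B,C^A)=0$. Moreover, it is unique up to isomorphism. (b) Let $\mathcal D:=\operatorname{Sub}\{U^A\mid A\in\mathcal A\cap\mathcal C\}$. Then $F:\mathcal E\to\mathcal B$ induces a dense functor $F:\mathcal C\to\mathcal D$. Assume in addition $\operatorname{Ext}^2_{\mathcal E}(\mathcal B,\mathcal A\cap\mathcal C)=0$. Then: (c) $U^A$ is an injective object of $\mathcal B$ for any $A\in\mathcal A\cap\mathcal C$. (d) $\mathcal D$ is closed under taking extensions in $\mathcal E$, and therefore forms an exact category. (e) Assume $\mathcal C\subset\mathcal E_2$ and that any object of $\mathcal A$ is projective in $\mathcal E$. Then $\mathcal C/[\mathcal A]$ inherits canonically the exact structure of $\mathcal C$, and $F:\mathcal C/[\mathcal A]\to\mathcal D$ is an equivalence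 of exact categories.
   Context: A torsion pair $(\mathcal X,\mathcal Y)$ in $\mathcal E$: full subcategories with $\operatorname{Hom}_{\mathcal E}(\mathcal X,\mathcal Y)=0$ such that every $E\in\mathcal E$ has a short exact sequence $0\to X\to E\to Y\to0$ with $X\in\mathcal X$, $Y\in\mathcal Y$. For $(\mathcal A,\mathcal B)$, $F$ sends $E$ to the $\mathcal B$-term of this sequence. Compatibility of $\mathcal B$: the short exact sequences of the abelian category $\mathcal B$ are exactly the short exact sequences of $\mathcal E$ with all terms in $\mathcal B$. $\operatorname{Ext}^i_{\mathcal E}$ is Yoneda Ext. $\mathcal E_2=\{X\in\mathcal E\mid\operatorname{Ext}^1_{\mathcal E}(X,\mathcal A)=0=\operatorname{Ext}^2_{\mathcal E}(X,\mathcal A)\}$. A $\mathcal B$-module is a contravariant additive functor $M:\mathcal B\to\mathrm{Ab}$, finitely generated if there is an epimorphism of functors $\operatorname{Hom}_{\mathcal B}(-,X)\to M$ for some $X\in\mathcal B$; $\operatorname{Ext}^1_{\mathcal E}(\mathcal B,A)$ denotes $\operatorname{Ext}^1_{\mathcal E}(-,A)|_{\mathcal B}$. $\operatorname{Sub}\mathcal X$ is the smallest full subcategory containing $\mathcal X$ and closed under direct sums and admissible subobjects (subobjects via admissible monomorphisms). $\mathcal C/[\mathcal A]$ is the quotient by the ideal of morphisms factoring through objects of $\mathcal A$; ''inherits canonically the exact structure'' means that the pairs of morphisms isomorphic to images of short exact sequences of $\mathcal C$ form an exact structure. An equivalence of exact categories is an equivalence that is exact and induces isomorphisms on $\operatorname{Ext}^1$.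 *)

(* Defs.v *)
From HB Require Import structures.
From Stdlib Require Import Relation_Operators.
From mathcomp Require Import all_boot all_order all_algebra.
From mathcomp Require Import ring_quotient boolp.

Set Implicit Arguments.
Unset Strict Implicit.
Unset Printing Implicit Defensive.

Import GRing.Theory.
Local Open Scope ring_scope.
Local Open Scope quotient_scope.

Record category := Category {
  Ob :> Type;
  Mor : Ob -> Ob -> zmodType;
  idm : forall X, Mor X X;
  mcomp : forall X Y Z, Mor Y Z -> Mor X Y -> Mor X Z;
  comp_idl : forall X Y (f : Mor X Y), mcomp (idm Y) f = f;
  comp_idr : forall X Y (f : Mor X Y), mcomp f (idm X) = f;
  comp_assoc : forall X Y Z W (h : Mor Z W) (g : Mor Y Z) (f : Mor X Y),
    mcomp h (mcomp g f) = mcomp (mcomp h g) f;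
  comp_addl : forall X Y Z (g g' : Mor Y Z) (f : Mor X Y),
    mcomp (g + g') f = mcomp g f + mcomp g' f;
  comp_addr : forall X Y Z (g : Mor Y Z) (f f' : Mor X Y),
    mcomp g (f + f') = mcomp g f + mcomp g f' }.

Arguments Mor {c} X Y.
Arguments idm {c} X.
Arguments mcomp {c X Y Z} g f.

(* [g \c f] is "f, then g" *)
Notation "g \c f" := (mcomp g f) (at level 40, left associativity).

Record functor (C D : category) := Functor {
  fobj :> C -> D;
  fmap : forall X Y : C, Mor X Y -> Mor (fobj X) (fobj Y);
  fmap_id : forall X, fmap (idm X) = idm (fobj X);
  fmap_comp : forall X Y Z (g : Mor Y Z) (f : Mor X Y),
    fmap (g \c f) = fmap g \c fmap f;
  fmap_add : forall X Y (f g : Mor X Y), fmap (f + g) = fmap f + fmap g }.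

Arguments fmap {C D} f {X Y} _ : rename.

Section Basics.
Variable C : category.
Implicit Types X Y Z W : C.

Definition is_iso X Y (f : Mor X Y) :=
  exists g : Mor Y X, g \c f = idm X /\ f \c g = idm Y.
Definition isomorphic X Y := exists f : Mor X Y, is_iso f.

Definition mono X Y (f : Mor X Y) :=
  forall W (g h : Mor W X), f \c g = f \c h -> g = h.
Definition epi X Y (f : Mor X Y) :=
  forall W (g h : Mor Y W), g \c f = h \c f -> g = h.

Definition is_kernel X Y Z (i : Mor X Y) (p : Mor Y Z) :=
  p \c i = 0 /\
  forall W (h : Mor W Y), p \c h = 0 -> exists! u : Mor W X, i \c u = h.
Definition is_cokernel X Y Z (i : Mor X Y) (p : Mor Y Z) :=
  p \c i = 0 /\
  forall W (h : Mor Y W), h \c i = 0 -> exists! u : Mor Z W, u \c p = h.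
Definition ker_coker_pair X Y Z (i : Mor X Y) (p : Mor Y Z) :=
  is_kernel i p /\ is_cokernel i p.

Definition zero_object Z :=
  forall X, (forall f : Mor X Z, f = 0) /\ (forall f : Mor Z X, f = 0).

Record biproduct X Y := Biproduct {
  bp_ob :> C;
  bp_in1 : Mor X bp_ob;
  bp_in2 : Mor Y bp_ob;
  bp_pr1 : Mor bp_ob X;
  bp_pr2 : Mor bp_ob Y;
  bp_11 : bp_pr1 \c bp_in1 = idm X;
  bp_22 : bp_pr2 \c bp_in2 = idm Y;
  bp_12 : bp_pr1 \c bp_in2 = 0;
  bp_21 : bp_pr2 \c bp_in1 = 0;
  bp_sum : bp_in1 \c bp_pr1 + bp_in2 \c bp_pr2 = idm bp_ob }.

Definition additive_category :=
  (exists Z, zero_object Z) /\ (forall X Y, inhabited (biproduct X Y)).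

Definition is_direct_sum n (X_ : 'I_n -> C) Y :=
  exists (i_ : forall k, Mor (X_ k) Y) (p_ : forall k, Mor Y (X_ k)),
    [/\ forall k, p_ k \c i_ k = idm (X_ k),
        forall k l, k != l -> p_ k \c i_ l = 0
      & \sum_(k < n) i_ k \c p_ k = idm Y].

(* The ring [End X] is local: nonzero, and the sum of two non-units is never
   a unit. *)
Definition local_End X :=
  idm X <> 0 /\
  forall f g : Mor X X, is_iso (f + g) -> is_iso f \/ is_iso g.

Definition krull_schmidt :=
  forall X, exists n (X_ : 'I_n -> C),
    (forall k, local_End (X_ k)) /\ is_direct_sum X_ X.

Definition abelian_category :=
  [/\ additive_category,
      forall X Y (f : Mor X Y), exists K (i : Mor K X), is_kernel i f,
      forall X Y (f : Mor X Y), exists Q (p : Mor Y Q), is_cokernel f p,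
      forall X Y (f : Mor X Y), mono f ->
        exists Z (p : Mor Y Z), is_kernel f p
    & forall X Y (f : Mor X Y), epi f ->
        exists Z (i : Mor Z X), is_cokernel i f].

Definition injective_object X :=
  forall Y Z (m : Mor Y Z), mono m ->
  forall f : Mor Y X, exists g : Mor Z X, g \c m = f.

Definition is_pushout X Y X' Y' (i : Mor X Y) (a : Mor X X')
    (b : Mor Y Y') (i' : Mor X' Y') :=
  b \c i = i' \c a /\
  forall W (s : Mor Y W) (t : Mor X' W), s \c i = t \c a ->
    exists! u : Mor Y' W, u \c b = s /\ u \c i' = t.
Definition is_pullback Y Z Y' Z' (p : Mor Y Z) (c : Mor Z' Z)
    (b : Mor Y' Y) (p' : Mor Y' Z') :=
  p \c b = c \c p' /\
  forall W (s : Mor W Y) (t : Mor W Z'), p \c s = c \c t ->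
    exists! u : Mor W Y', b \c u = s /\ p' \c u = t.

Definition pair_class := forall X Y Z, Mor X Y -> Mor Y Z -> Prop.

Definition iso_pairs X Y Z X' Y' Z' (i : Mor X Y) (p : Mor Y Z)
    (i' : Mor X' Y') (p' : Mor Y' Z') :=
  exists (x : Mor X X') (y : Mor Y Y') (z : Mor Z Z'),
    [/\ is_iso x, is_iso y, is_iso z, y \c i = i' \c x & z \c p = p' \c y].
End Basics.

Arguments ker_coker_pair {C X Y Z} i p.

Section Exact.
Variables (C : category) (S : pair_class C).
Implicit Types X Y Z W : C.

Definition inflation X Y (i : Mor X Y) := exists Z (p : Mor Y Z), S i p.
Definition deflation Y Z (p : Mor Y Z) := exists X (i : Mor X Y), S i p.

(* Quillen's axioms, in Buehler's form *)
Record exact_category : Prop := ExactCategory {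
  exact_additive : additive_category C;
  exact_ker_coker : forall X Y Z (i : Mor X Y) (p : Mor Y Z),
    S i p -> ker_coker_pair i p;
  exact_iso : forall X Y Z X' Y' Z' (i : Mor X Y) (p : Mor Y Z)
    (i' : Mor X' Y') (p' : Mor Y' Z'), iso_pairs i p i' p' -> S i p -> S i' p';
  exact_id_inflation : forall X, inflation (idm X);
  exact_id_deflation : forall X, deflation (idm X);
  exact_comp_inflation : forall X Y Z (j : Mor Y Z) (i : Mor X Y),
    inflation i -> inflation j -> inflation (j \c i);
  exact_comp_deflation : forall X Y Z (q : Mor Y Z) (p : Mor X Y),
    deflation p -> deflation q -> deflation (q \c p);
  exact_pushout : forall X Y X' (i : Mor X Y) (a : Mor X X'), inflation i ->
    exists Y' (b : Mor Y Y') (i' : Mor X' Y'),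
      is_pushout i a b i' /\ inflation i';
  exact_pullback : forall Y Z Z' (p : Mor Y Z) (c : Mor Z' Z), deflation p ->
    exists Y' (b : Mor Y' Y) (p' : Mor Y' Z'),
      is_pullback p c b p' /\ deflation p' }.

Definition projective_object X :=
  forall Y Z (p : Mor Y Z), deflation p ->
  forall f : Mor X Z, exists g : Mor X Y, p \c g = f.

Definition extension_closed (P : C -> Prop) :=
  forall X Y Z (i : Mor X Y) (p : Mor Y Z), S i p -> P X -> P Z -> P Y.

Definition torsion_pair (P Q : C -> Prop) :=
  (forall X Y, P X -> Q Y -> forall f : Mor X Y, f = 0) /\
  (forall E, exists X Y (i : Mor X E) (p : Mor E Y), [/\ P X, Q Y & S i p]).

Inductive Sub_cl (P : C -> Prop) : C -> Prop :=
| Sub_cl_gen X : P X -> Sub_cl P X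
| Sub_cl_sum X Y (b : biproduct X Y) : Sub_cl P X -> Sub_cl P Y -> Sub_cl P b
| Sub_cl_inflation X Y (i : Mor X Y) : inflation i -> Sub_cl P Y -> Sub_cl P X.

Record ext X A := Extension {
  ext_mid : C;
  ext_inf : Mor A ext_mid;
  ext_def : Mor ext_mid X;
  ext_conf : S ext_inf ext_def }.

Definition ext_mor X A X' A' (a : Mor A A') (x : Mor X X')
    (s : ext X A) (s' : ext X' A') :=
  exists h : Mor (ext_mid s) (ext_mid s'),
    h \c ext_inf s = ext_inf s' \c a /\ ext_def s' \c h = x \c ext_def s.

(* [yext n X A]: exact sequences 0 -> A -> E_n -> ... -> E_0 -> X -> 0,
   cut into conflations. Beware of the shift: they represent the elements of
   Ext^(n+1)(X, A). *)
Fixpoint yext (n : nat) X A : Type :=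
  if n is m.+1 then {K : C & (ext X K * yext m K A)%type} else ext X A.

Fixpoint yext_mor (n : nat) X A X' A' (a : Mor A A') (x : Mor X X') {struct n} :
    yext n X A -> yext n X' A' -> Prop :=
  match n with
  | 0 => fun s s' => ext_mor a x s s'
  | m.+1 => fun s s' => exists k : Mor (projT1 s) (projT1 s'),
      ext_mor k x (projT2 s).1 (projT2 s').1 /\
      yext_mor a k (projT2 s).2 (projT2 s').2
  end.

Definition yext_equiv n X A : yext n X A -> yext n X A -> Prop :=
  clos_refl_sym_trans _ (yext_mor (idm A) (idm X)).
Definition ext_equiv X A : ext X A -> ext X A -> Prop := @yext_equiv 0 X A.

(* A group is zero iff it has at most one element. *)
Definition Ext1_eq0 X A := forall s s' : yext 0 X A, yext_equiv s s'.
Definition Ext2_eq0 X A := forall s s' : yext 1 X A, yext_equiv s s'.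

(* In an exact category [ext_mor (idm A) x s s'] says that [s] is the pullback
   of [s'] along [x], and dually; thus [t] below is the direct sum of [s1] and
   [s2], and the Baer sum [s3] is nabla_* Delta^* t. *)
Definition baer_sum X A (s1 s2 s3 : ext X A) :=
  exists (AA : biproduct A A) (XX : biproduct X X)
         (t : ext XX AA) (w : ext X AA),
    [/\ ext_mor (bp_in1 AA) (bp_in1 XX) s1 t,
        ext_mor (bp_in2 AA) (bp_in2 XX) s2 t,
        ext_mor (idm AA) (bp_in1 XX + bp_in2 XX) w t
      & ext_mor (bp_pr1 AA + bp_pr2 AA) (idm X) w s3].

End Exact.

Section Functors.
Variables C D : category.

Definition dense (F : functor C D) :=
  forall Y : D, exists X : C, isomorphic (F X) Y.

Definition natural_iso (F G : functor C D) :=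
  exists eta : forall X, Mor (F X) (G X),
    (forall X, is_iso (eta X)) /\
    (forall X Y (f : Mor X Y), eta Y \c fmap F f = fmap G f \c eta X).

Record adjunction (F : functor C D) (G : functor D C) := Adjunction {
  adj : forall X Y, Mor (F X) Y -> Mor X (G Y);
  adj_bij : forall X Y, bijective (@adj X Y);
  adj_nat : forall X X' Y Y' (f : Mor X' X) (h : Mor (F X) Y) (k : Mor Y Y'),
    adj (k \c h \c fmap F f) = fmap G k \c adj h \c f }.

Variables (S : pair_class C) (T : pair_class D).

Definition exact_functor (F : functor C D) :=
  forall X Y Z (i : Mor X Y) (p : Mor Y Z), S i p -> T (fmap F i) (fmap F p).

Definition ext_map (F : functor C D) (hF : exact_functor F) X A
    (s : ext S X A) : ext T (F X) (F A) :=
  Extension (hF _ _ _ _ _ (ext_conf s)).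

(* bijective on classes, and compatible with addition *)
Definition Ext1_iso (F : functor C D) (hF : exact_functor F) :=
  forall X A,
    [/\ forall s s' : ext S X A,
          ext_equiv (ext_map hF s) (ext_map hF s') <-> ext_equiv s s',
        forall t : ext T (F X) (F A), exists s, ext_equiv (ext_map hF s) t
      & forall s1 s2 s3 : ext S X A, baer_sum s1 s2 s3 ->
          baer_sum (ext_map hF s1) (ext_map hF s2) (ext_map hF s3)].

Definition image_class (F : functor C D) : pair_class D :=
  fun X Y Z f g => exists (X' Y' Z' : C) (i : Mor X' Y') (p : Mor Y' Z'),
    S i p /\ iso_pairs (fmap F i) (fmap F p) f g.
End Functors.

Definition id_functor (C : category) : functor C C :=
  @Functor C C id (fun _ _ => id)
    (fun _ => erefl) (fun _ _ _ _ _ => erefl) (fun _ _ _ _ => erefl).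

Program Definition comp_functor (C D E : category)
    (G : functor D E) (F : functor C D) : functor C E :=
  @Functor C E (fun X => G (F X)) (fun _ _ f => fmap G (fmap F f)) _ _ _.
Next Obligation. by rewrite !fmap_id. Qed.
Next Obligation. by rewrite !fmap_comp. Qed.
Next Obligation. by rewrite !fmap_add. Qed.

Definition equivalence (C D : category) (F : functor C D) :=
  exists G : functor D C,
    natural_iso (comp_functor G F) (id_functor C) /\
    natural_iso (comp_functor F G) (id_functor D).

Definition exact_equivalence (C D : category) (S : pair_class C)
    (T : pair_class D) (F : functor C D) :=
  equivalence F /\ exists hF : exact_functor S T F, Ext1_iso hF.

Definition full_sub (C : category) (P : C -> Prop) : category :=
  @Category {X : C | P X} (fun X Y => Mor (sval X) (sval Y))
    (fun X => idm (sval X)) (fun _ _ _ g f => g \c f)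
    (fun _ _ => @comp_idl C _ _) (fun _ _ => @comp_idr C _ _)
    (fun _ _ _ _ => @comp_assoc C _ _ _ _)
    (fun _ _ _ => @comp_addl C _ _ _) (fun _ _ _ => @comp_addr C _ _ _).

Definition incl (C : category) (P : C -> Prop) : functor (full_sub P) C :=
  @Functor (full_sub P) C sval (fun _ _ => id)
    (fun _ => erefl) (fun _ _ _ _ _ => erefl) (fun _ _ _ _ => erefl).

Definition sub_class (C : category) (S : pair_class C) (P : C -> Prop) :
    pair_class (full_sub P) :=
  fun X Y Z i p => @S (sval X) (sval Y) (sval Z) i p.

Program Definition restrict (C D : category) (F : functor C D)
    (P : C -> Prop) (Q : D -> Prop) (h : forall X, P X -> Q (F X)) :
    functor (full_sub P) (full_sub Q) :=
  @Functor (full_sub P) (full_sub Q)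
    (fun X => exist Q (F (sval X)) (h _ (proj2_sig X)))
    (fun X Y f => @fmap C D F (sval X) (sval Y) f) _ _ _.
Next Obligation. exact: fmap_id. Qed.
Next Obligation. exact: fmap_comp. Qed.
Next Obligation. exact: fmap_add. Qed.

Record ideal (C : category) := Ideal {
  ideal_mem :> forall X Y : C, zmodClosed (Mor X Y);
  ideal_compl : forall X Y Z (g : Mor Y Z) (f : Mor X Y),
    f \in ideal_mem X Y -> g \c f \in ideal_mem X Z;
  ideal_compr : forall X Y Z (g : Mor Y Z) (f : Mor X Y),
    g \in ideal_mem Y Z -> g \c f \in ideal_mem X Z }.

Section CompTheory.
Variable C : category.

Lemma comp0l (X Y Z : C) (f : Mor X Y) : (0 : Mor Y Z) \c f = 0.
Proof.
by apply: (@addrI _ ((0 : Mor Y Z) \c f)); rewrite -comp_addl !addr0.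
Qed.

Lemma comp0r (X Y Z : C) (g : Mor Y Z) : g \c (0 : Mor X Y) = 0.
Proof.
by apply: (@addrI _ (g \c (0 : Mor X Y))); rewrite -comp_addr !addr0.
Qed.

Lemma compNl (X Y Z : C) (g : Mor Y Z) (f : Mor X Y) : (- g) \c f = - (g \c f).
Proof. by apply: (addrI (g \c f)); rewrite -comp_addl !subrr comp0l. Qed.

Lemma compNr (X Y Z : C) (g : Mor Y Z) (f : Mor X Y) : g \c (- f) = - (g \c f).
Proof. by apply: (addrI (g \c f)); rewrite -comp_addr !subrr comp0r. Qed.
End CompTheory.

Section Quotient.
Variables (C : category) (I : ideal C).

Definition qHom (X Y : C) : zmodType := Quotient.quot (I X Y).
Definition qmk (X Y : C) (f : Mor X Y) : qHom X Y :=
  \pi_(Quotient.quot (I X Y)) f.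
Definition qcomp (X Y Z : C) (g : qHom Y Z) (f : qHom X Y) : qHom X Z :=
  qmk (repr g \c repr f).

Lemma qmk_eq (X Y : C) (f g : Mor X Y) : qmk f = qmk g <-> f - g \in I X Y.
Proof. by rewrite Quotient.idealrBE; split=> [/eqP|/eqP]. Qed.

Lemma qmk_repr (X Y : C) (f : qHom X Y) : qmk (repr f) = f.
Proof. exact: reprK. Qed.

Lemma qmkD (X Y : C) (f g : Mor X Y) : qmk (f + g) = qmk f + qmk g.
Proof. exact: raddfD. Qed.

Lemma qcomp_mk (X Y Z : C) (g : Mor Y Z) (f : Mor X Y) :
  qcomp (qmk g) (qmk f) = qmk (g \c f).
Proof.
apply/qmk_eq; set g' := repr _; set f' := repr _.
have hg : g' - g \in I Y Z by apply/qmk_eq; rewrite qmk_repr.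
have hf : f' - f \in I X Y by apply/qmk_eq; rewrite qmk_repr.
have -> : g' \c f' - g \c f = g' \c (f' - f) + (g' - g) \c f.
  by rewrite comp_addr comp_addl compNl compNr addrA subrK.
by apply: rpredD; [exact: ideal_compl | exact: ideal_compr].
Qed.

Program Definition quotient_cat : category :=
  @Category C qHom (fun X => qmk (idm X)) qcomp _ _ _ _ _.
Next Obligation. by rewrite -(qmk_repr f) qcomp_mk comp_idl. Qed.
Next Obligation. by rewrite -(qmk_repr f) qcomp_mk comp_idr. Qed.
Next Obligation.
by rewrite -(qmk_repr f) -(qmk_repr g) -(qmk_repr h) !qcomp_mk comp_assoc.
Qed.
Next Obligation.
rewrite -(qmk_repr f) -(qmk_repr g) -(qmk_repr g') -qmkD !qcomp_mk.
by rewrite comp_addl qmkD.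
Qed.
Next Obligation.
rewrite -(qmk_repr f) -(qmk_repr g) -(qmk_repr f') -qmkD !qcomp_mk.
by rewrite comp_addr qmkD.
Qed.

Program Definition quotient_proj : functor C quotient_cat :=
  @Functor C quotient_cat id (@qmk) _ _ _.
Next Obligation. by rewrite -qcomp_mk. Qed.
Next Obligation. by rewrite qmkD. Qed.

Section Lift.
Variables (D : category) (F : functor C D).
Definition kills := forall X Y (f : Mor X Y), f \in I X Y -> fmap F f = 0.
Hypothesis hF : kills.

Lemma kills_repr (X Y : C) (f : Mor X Y) : fmap F (repr (qmk f)) = fmap F f.
Proof.
have /hF h : repr (qmk f) - f \in I X Y by apply/qmk_eq; rewrite qmk_repr.
by rewrite -[repr _](subrK f) fmap_add h add0r.
Qed.

Program Definition quotient_lift : functor quotient_cat D :=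
  @Functor quotient_cat D F (fun X Y (f : qHom X Y) => fmap F (repr f)) _ _ _.
Next Obligation. by rewrite kills_repr fmap_id. Qed.
Next Obligation. by rewrite kills_repr fmap_comp. Qed.
Next Obligation.
by rewrite -{1}(qmk_repr f) -{1}(qmk_repr g) -qmkD kills_repr fmap_add.
Qed.
End Lift.
End Quotient.

(* The ideal [A] of the full subcategory [P]: the morphisms that factor, in the
   ambient category, through an object of [A]. *)
Section FactorIdeal.
Variables (C : category) (A P : C -> Prop).

Definition factors_through (X Y : C) (f : Mor X Y) :=
  exists (Z : C) (u : Mor X Z) (v : Mor Z Y), A Z /\ f = v \c u.

Definition sum_closed :=
  (exists Z : C, A Z) /\
  (forall X Y : C, A X -> A Y -> exists b : biproduct X Y, A b).

Hypothesis hA : sum_closed.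

Definition factor_pred (X Y : full_sub P) : pred (Mor X Y) :=
  fun f => `[< @factors_through (sval X) (sval Y) f >].

Fact factor_zmod_closed X Y : zmod_closed (@factor_pred X Y).
Proof.
have [[Z AZ] hsum] := hA; split=> [|f g].
  by apply/asboolP; exists Z, 0, 0; split; rewrite ?comp0l.
move=> /asboolP [U [u [v [AU ->]]]] /asboolP [V [u' [v' [AV ->]]]].
apply/asboolP; have [b Ab] := hsum _ _ AU AV.
exists b, (bp_in1 b \c u + bp_in2 b \c u').
exists (v \c bp_pr1 b - v' \c bp_pr2 b); split=> //.
rewrite comp_addr !comp_addl !compNl -!comp_assoc.
rewrite !(comp_assoc (bp_pr1 b)) !(comp_assoc (bp_pr2 b)).
by rewrite bp_11 bp_12 bp_21 bp_22 !comp_idl !comp0l !comp0r subr0 add0r.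
Qed.

Definition factor_zmodClosed X Y : zmodClosed (Mor X Y) :=
  HB.pack (@factor_pred X Y)
    (GRing.isZmodClosed.Build (Mor X Y) (@factor_pred X Y)
       (@factor_zmod_closed X Y)).

Program Definition factor_ideal : ideal (full_sub P) :=
  @Ideal (full_sub P) factor_zmodClosed _ _.
Next Obligation.
move: H => /asboolP [U [u [v [AU ->]]]].
by apply/asboolP; exists U, u, (g \c v); rewrite -comp_assoc.
Qed.
Next Obligation.
move: H => /asboolP [U [u [v [AU ->]]]].
by apply/asboolP; exists U, (u \c f), v; rewrite -comp_assoc.
Qed.
End FactorIdeal.

Lemma torsion_sum_closed (C : category) (S : pair_class C) (A B : C -> Prop) :
  exact_category S -> torsion_pair S A B -> sum_closed A.
Proof.
move=> hS [hom0 hses].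
have [[Z _] hsum] := exact_additive hS.
split; first by have [X [_ [_ [_ [AX _ _]]]]] := hses Z; exists X.
move=> X Y AX AY; have [b] := hsum X Y.
have [X' [Y' [i [p [AX' BY' Sip]]]]] := hses b.
have [[pi0 ker] _] := exact_ker_coker hS Sip.
have p0 : p = 0.
  rewrite -(comp_idr p) -(bp_sum b) comp_addr !comp_assoc.
  by rewrite (hom0 _ _ AX BY' (p \c bp_in1 b))
             (hom0 _ _ AY BY' (p \c bp_in2 b)) !comp0l addr0.
have [j [ij _]] : exists! u, i \c u = idm b by apply: ker; rewrite p0 comp0l.
have ji : j \c i = idm X'.
  have [u [_ uniq]] : exists! u, i \c u = i by apply: ker; rewrite pi0.
  by rewrite -(uniq (idm X')) ?comp_idr // (uniq (j \c i)) // comp_assoc ij comp_idl.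
unshelve eexists (@Biproduct C X Y X' (j \c bp_in1 b) (j \c bp_in2 b)
  (bp_pr1 b \c i) (bp_pr2 b \c i) _ _ _ _ _) => //.
- by rewrite comp_assoc -(comp_assoc _ i) ij comp_idr bp_11.
- by rewrite comp_assoc -(comp_assoc _ i) ij comp_idr bp_22.
- by rewrite comp_assoc -(comp_assoc _ i) ij comp_idr bp_12.
- by rewrite comp_assoc -(comp_assoc _ i) ij comp_idr bp_21.
rewrite !comp_assoc -!(comp_assoc j) -comp_addr -comp_addl bp_sum.
by rewrite comp_idl ji.
Qed.

Record module (B : category) := Module {
  mod_ob :> B -> zmodType;
  mod_act : forall X Y : B, Mor X Y -> mod_ob Y -> mod_ob X;
  mod_id : forall X (m : mod_ob X), mod_act (idm X) m = m;
  mod_comp : forall X Y Z (g : Mor Y Z) (f : Mor X Y) (m : mod_ob Z),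
    mod_act (g \c f) m = mod_act f (mod_act g m);
  mod_addl : forall X Y (f g : Mor X Y) (m : mod_ob Y),
    mod_act (f + g) m = mod_act f m + mod_act g m;
  mod_addr : forall X Y (f : Mor X Y) (m n : mod_ob Y),
    mod_act f (m + n) = mod_act f m + mod_act f n }.

Arguments mod_act {B} m {X Y} _ _ : rename.

Definition hom_module (B : category) (X : B) : module B :=
  @Module B (fun Y => Mor Y X) (fun _ _ f g => g \c f)
    (fun _ => @comp_idr B _ _)
    (fun _ _ _ _ _ _ => @comp_assoc B _ _ _ _ _ _ _)
    (fun _ _ f g m => @comp_addr B _ _ _ m f g)
    (fun _ _ f m n => @comp_addl B _ _ _ m n f).

Record module_mor (B : category) (M N : module B) := ModuleMor {
  mmor :> forall X, {additive M X -> N X};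
  mmor_nat : forall X Y (f : Mor X Y) (m : M Y),
    mmor X (mod_act M f m) = mod_act N f (mmor Y m) }.

(* The epimorphisms of functors to Ab are the pointwise surjections. *)
Definition module_epi (B : category) (M N : module B) (phi : module_mor M N) :=
  forall X (n : N X), exists m : M X, phi X m = n.

Definition finitely_generated (B : category) (M : module B) :=
  exists (X : B) (phi : module_mor (hom_module X) M), module_epi phi.

Section ExtModule.
Variables (E : category) (S : pair_class E) (B : E -> Prop).

(* [M] is (isomorphic to) the functor Ext^1(-, A) restricted to [B]: [theta]
   identifies [M Y] with the classes of extensions of [Y] by [A], the action
   with pullback, and the addition with the Baer sum. *)
Definition is_Ext1_module (A : E) (M : module (full_sub B)) :=
  exists theta : forall Y : full_sub B, M Y -> ext S (sval Y) A,
    [/\ forall Y (m n : M Y), ext_equiv (theta Y m) (theta Y n) -> m = n,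
        forall Y (s : ext S (sval Y) A), exists m, ext_equiv (theta Y m) s,
        forall X Y (f : @Mor (full_sub B) X Y) (m : M Y),
          @ext_mor E S (sval X) A (sval Y) A (idm A) f
            (theta X (mod_act M f m)) (theta Y m)
      & forall Y (m n : M Y),
          baer_sum (theta Y m) (theta Y n) (theta Y (m + n))].

Definition Ext1_finitely_generated (A : E) :=
  exists M : module (full_sub B), is_Ext1_module A M /\ finitely_generated M.
End ExtModule.

Section Setting.
Variables (E : category) (S : pair_class E) (A B C : E -> Prop).

Definition CU_sequence (X CX UX : E) (i : Mor X CX) (p : Mor CX UX) :=
  [/\ S i p, B UX, C CX & forall Y, B Y -> Ext1_eq0 S Y CX].

(* [U] is (a choice of) U^X *)
Definition is_U (X U : E) :=
  exists (CX : E) (i : Mor X CX) (p : Mor CX U), CU_sequence i p.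

(* [Sub_cl] is closed under isomorphism, so no choice of the U^X matters here. *)
Definition D_sub : E -> Prop :=
  Sub_cl S (fun U => exists X : E, [/\ A X, C X & is_U X U]).

Definition in_E2 (X : E) :=
  forall Y, A Y -> Ext1_eq0 S X Y /\ Ext2_eq0 S X Y.
End Setting.

(* Main.v *)
Require Import Defs.
From Stdlib Require Import Relation_Operators.
From mathcomp Require Import all_boot all_order all_algebra.
From mathcomp Require Import boolp.

Set Implicit Arguments.
Unset Strict Implicit.
Unset Printing Implicit Defensive.

Import GRing.Theory.
Local Open Scope ring_scope.

(* The idea is that [U^A] represents [Ext^1(-,A)] on [B].  Finite generation
   gives an extension [Z0] of some [U0] in [B] by [A] of which every extension of
   an object of [B] by [A] is a pullback; dividing [Z0] and [U0] by the
   [B]-torsion part [T] of [Z0] (which meets [A] trivially, so it embeds into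
   [U0]) keeps this versality and produces [C^A = Z0/T] and [U^A = U0/T].
   Versality gives [Ext^1(B,C^A) = 0], as in Wakamatsu's lemma.

   For [X] in [C] with [A]-part [K], the extension [X] of [F X] is the pullback
   of that of [U^K] along a map [F X -> U^K], which is monic since
   [Hom(B,X) = 0]; so [F X] lies in [D].  Conversely the objects of [D] are the
   quotients in [B] of objects of [C] with kernel left orthogonal to [B].

   [Ext^2(B,A) = 0] allows extensions by [A] to be prolonged along monomorphisms
   of [B], hence [U^A] is injective, and an extension of two objects of [D]
   embeds into a sum of two injectives [U^A].

   For (e), a morphism of [C] killed by [F] factors through the [A]-part of its
   target; [Ext^1(C,A) = 0] makes [F] full; projectivity of [A] makes [F] exact;
   and [Ext^2(C,A) = 0] lifts every conflation of [D] to [C].  So the class of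
   pairs induced on [C/[A]] is the preimage of the exact structure of [D] under
   an equivalence. *)

(** * Additive categories and duality *)

Section CategoryTheory.
Variable C : category.
Implicit Types X Y Z W : C.

Lemma compBl X Y Z (g g' : Mor Y Z) (f : Mor X Y) :
  (g - g') \c f = g \c f - g' \c f.
Proof. by rewrite comp_addl compNl. Qed.

Lemma compBr X Y Z (g : Mor Y Z) (f f' : Mor X Y) :
  g \c (f - f') = g \c f - g \c f'.
Proof. by rewrite comp_addr compNr. Qed.

Lemma comp_mid X Y Z Z' W (f : Mor X Y) (g : Mor Y Z) (f' : Mor X Z')
    (g' : Mor Z' Z) (h : Mor Z W) :
  g \c f = g' \c f' -> h \c g \c f = h \c g' \c f'.
Proof. by move=> e; rewrite -comp_assoc e comp_assoc. Qed.

Lemma mono0 X Y (f : Mor X Y) :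
  (forall W (g : Mor W X), f \c g = 0 -> g = 0) -> mono f.
Proof.
by move=> h W g g' e; apply/subr0_eq/h; rewrite compBr e subrr.
Qed.

Lemma is_iso_id X : is_iso (idm X).
Proof. by exists (idm X); rewrite comp_idl. Qed.

Lemma isomorphic_refl X : isomorphic X X.
Proof. by exists (idm X); apply: is_iso_id. Qed.

Lemma isomorphic_sym X Y : isomorphic X Y -> isomorphic Y X.
Proof. by move=> [f [g [gf fg]]]; exists g, f. Qed.

Lemma iso_mono X Y (f : Mor X Y) : is_iso f -> mono f.
Proof.
move=> [g [gf _]] W u v e.
by rewrite -(comp_idl u) -(comp_idl v) -gf -!comp_assoc e.
Qed.

Lemma iso_epi X Y (f : Mor X Y) : is_iso f -> epi f.
Proof.
move=> [g [_ fg]] W u v e.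
by rewrite -(comp_idr u) -(comp_idr v) -fg !comp_assoc e.
Qed.

Lemma iso_pairs_sym X Y Z X' Y' Z' (i : Mor X Y) (p : Mor Y Z)
    (i' : Mor X' Y') (p' : Mor Y' Z') :
  iso_pairs i p i' p' -> iso_pairs i' p' i p.
Proof.
move=> [x [y [z [[x' [x'x xx']] [y' [y'y yy']] [z' [z'z zz']] e1 e2]]]].
exists x', y', z'; split; [by exists x | by exists y | by exists z | |].
  by rewrite -[LHS]comp_idr -xx' comp_assoc -(comp_mid _ e1) y'y comp_idl.
by rewrite -[LHS]comp_idr -yy' comp_assoc -(comp_mid _ e2) z'z comp_idl.
Qed.

Lemma zero_mor_uniq X Z (f g : Mor X Z) : zero_object Z -> f = g.
Proof. by move=> hZ; have [h _] := hZ X; rewrite (h f) (h g). Qed.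

Lemma pullback_eq X Y Y' Z W (p : Mor Y Z) (c : Mor Y' Z) (b : Mor X Y)
    (p' : Mor X Y') (u v : Mor W X) :
  is_pullback p c b p' -> b \c u = b \c v -> p' \c u = p' \c v -> u = v.
Proof.
move=> [e uni] hb hp'.
have [w [_ hw]] := uni W (b \c v) (p' \c v)
  ltac:(by rewrite !comp_assoc e).
by rewrite -(hw u) // -(hw v).
Qed.

Lemma is_pullback_sym Y Z Y' Z' (p : Mor Y Z)
    (c : Mor Z' Z) (b : Mor Y' Y) (p' : Mor Y' Z') :
  is_pullback p c b p' -> is_pullback c p p' b.
Proof.
move=> [e uni]; split=> [|W s t st]; first by rewrite e.
have [u [[us ut] hu]] := uni W t s (esym st).
by exists u; split=> // v [vs vt]; apply: hu.
Qed.

Lemma biprod_ext X Y W (b : biproduct X Y) (u v : Mor W b) :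
  bp_pr1 b \c u = bp_pr1 b \c v -> bp_pr2 b \c u = bp_pr2 b \c v -> u = v.
Proof.
move=> e1 e2; rewrite -(comp_idl u) -(comp_idl v) -(bp_sum b) !comp_addl.
by rewrite -!comp_assoc e1 e2.
Qed.

End CategoryTheory.

(** * Opposite categories *)

Definition op_cat (C : category) : category :=
  @Category C (fun X Y => Mor Y X) (@idm C) (fun _ _ _ g f => f \c g)
    (fun _ _ => @comp_idr C _ _) (fun _ _ => @comp_idl C _ _)
    (fun _ _ _ _ h g f => esym (comp_assoc f g h))
    (fun _ _ _ g g' f => comp_addr f g g')
    (fun _ _ _ g f f' => comp_addl f f' g).

Definition op_class (C : category) (S : pair_class C) : pair_class (op_cat C) :=
  fun X Y Z i p => @S Z Y X p i.

Lemma is_iso_op (C : category) (X Y : C) (f : Mor X Y) :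
  is_iso f -> @is_iso (op_cat C) Y X f.
Proof. by move=> [g [gf fg]]; exists g. Qed.

Lemma op_is_iso (C : category) (X Y : C) (f : Mor X Y) :
  @is_iso (op_cat C) Y X f -> is_iso f.
Proof. by move=> [g [gf fg]]; exists g. Qed.

Definition op_biproduct (C : category) (X Y : C) (b : biproduct X Y) :
  @biproduct (op_cat C) X Y :=
  @Biproduct (op_cat C) X Y b (bp_pr1 b) (bp_pr2 b) (bp_in1 b) (bp_in2 b)
    (bp_11 b) (bp_22 b) (bp_21 b) (bp_12 b) (bp_sum b).

Lemma additive_op (C : category) :
  additive_category C -> additive_category (op_cat C).
Proof.
move=> [[Z hZ] hsum]; split.
  by exists Z => X; have [h1 h2] := hZ X; split.
by move=> X Y; have [b] := hsum X Y; constructor; apply: op_biproduct.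
Qed.

(** The axioms are self-dual. An isomorphism of pairs changes direction in the opposite category,
    whence the use of [iso_pairs_sym]. *)
Lemma exact_op (C : category) (S : pair_class C) :
  exact_category S -> exact_category (op_class S).
Proof.
move=> hS; split.
- exact/additive_op/exact_additive/hS.
- by move=> X Y Z i p /(exact_ker_coker hS) [hk hc].
- move=> X Y Z X' Y' Z' i p i' p' [x [y [z [hx hy hz e1 e2]]]].
  apply/(exact_iso hS)/iso_pairs_sym; exists z, y, x.
  by split; [exact: op_is_iso.. | exact: esym e2 | exact: esym e1].
- exact: (exact_id_deflation hS).
- exact: (exact_id_inflation hS).
- by move=> X Y Z j i hi hj; apply: (exact_comp_deflation hS).
- by move=> X Y Z q p hp hq; apply: (exact_comp_inflation hS).
- by move=> X Y X' i a /(exact_pullback hS a).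
- by move=> X Y X' i a /(exact_pushout hS a).
Qed.

(** * Exact categories *)

Section ExactTheory.
Variables (E : category) (S : pair_class E).
Hypothesis hS : exact_category S.
Implicit Types X Y Z W : E.

Lemma conf0 X Y Z (i : Mor X Y) (p : Mor Y Z) : S i p -> p \c i = 0.
Proof. by move=> /(exact_ker_coker hS) [[]]. Qed.

Lemma conf_lift X Y Z (i : Mor X Y) (p : Mor Y Z) W (h : Mor W Y) :
  S i p -> p \c h = 0 -> exists u, i \c u = h.
Proof.
by move=> /(exact_ker_coker hS) [[_ hk] _] /hk [u [hu _]]; exists u.
Qed.

Lemma conf_desc X Y Z (i : Mor X Y) (p : Mor Y Z) W (h : Mor Y W) :
  S i p -> h \c i = 0 -> exists u, u \c p = h.
Proof.
by move=> /(exact_ker_coker hS) [_ [_ hk]] /hk [u [hu _]]; exists u.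
Qed.

Lemma conf_mono X Y Z (i : Mor X Y) (p : Mor Y Z) : S i p -> mono i.
Proof.
move=> /(exact_ker_coker hS) [[pi0 hk] _] W u v e.
have [|w [_ hw]] := hk W (i \c u); first by rewrite comp_assoc pi0 comp0l.
by rewrite -(hw u) // -(hw v).
Qed.

Lemma conf_epi X Y Z (i : Mor X Y) (p : Mor Y Z) : S i p -> epi p.
Proof.
move=> /(exact_ker_coker hS) [_ [pi0 hk]] W u v e.
have [|w [_ hw]] := hk W (u \c p); first by rewrite -comp_assoc pi0 comp0r.
by rewrite -(hw u) // -(hw v).
Qed.

Lemma conf_mono0 X Y Z (i : Mor X Y) (p : Mor Y Z) W (u : Mor W X) :
  S i p -> i \c u = 0 -> u = 0.
Proof. by move=> /conf_mono h e; apply: h; rewrite e comp0r. Qed.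

Lemma conf_epi0 X Y Z (i : Mor X Y) (p : Mor Y Z) W (u : Mor Z W) :
  S i p -> u \c p = 0 -> u = 0.
Proof. by move=> /conf_epi h e; apply: h; rewrite e comp0l. Qed.

Lemma conf_iso X Y Z X' Y' Z' (i : Mor X Y) (p : Mor Y Z)
    (i' : Mor X' Y') (p' : Mor Y' Z') x y z :
  is_iso x -> is_iso y -> is_iso z -> y \c i = i' \c x -> z \c p = p' \c y ->
  S i p -> S i' p'.
Proof. by move=> *; apply: (exact_iso hS) (_ : S i p) => //; exists x, y, z. Qed.

(** Some cokernel completes the inflation to a conflation; any other one is isomorphic to it, and
    [S] is closed under isomorphism. *)
Lemma cokernel_conf X Y Z (i : Mor X Y) (p : Mor Y Z) :
  inflation S i -> is_cokernel i p -> S i p.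
Proof.
move=> [Z' [p' Sip]] [pi0 hk].
have [f ef] := conf_desc Sip pi0.
have [g [eg _]] := hk _ _ (conf0 Sip).
apply: (conf_iso (z := f) (is_iso_id X) (is_iso_id Y) _ _ _ Sip).
- exists g; split; first by apply: (conf_epi Sip); rewrite -comp_assoc ef eg comp_idl.
  have [w [_ hw]] := hk _ _ pi0.
  rewrite -(hw (idm Z)) ?comp_idl // (hw (f \c g)) //.
  by rewrite -comp_assoc eg ef.
- by rewrite comp_idl comp_idr.
by rewrite ef comp_idr.
Qed.

Lemma iso_inflation X Y (f : Mor X Y) : is_iso f -> inflation S f.
Proof.
move=> hf; have [g [gf fg]] := hf.
have [Z [p Sp]] := exact_id_inflation hS X.
exists Z, (p \c g); apply: (conf_iso (is_iso_id X) hf (is_iso_id Z) _ _ Sp).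
  by rewrite !comp_idr.
by rewrite comp_idl -comp_assoc gf comp_idr.
Qed.

Lemma conf_isor X Y Z Z' (i : Mor X Y) (p : Mor Y Z) (z : Mor Z Z') :
  S i p -> is_iso z -> S i (z \c p).
Proof.
move=> Sip hz; apply: (conf_iso (is_iso_id X) (is_iso_id Y) hz _ _ Sip).
  by rewrite comp_idl comp_idr.
by rewrite comp_idr.
Qed.

Lemma conf_coker_uniq X Y Z Z' (i : Mor X Y) (p : Mor Y Z) (p' : Mor Y Z') :
  S i p -> S i p' -> exists2 z : Mor Z Z', is_iso z & z \c p = p'.
Proof.
move=> Sp Sp'; have [f ef] := conf_desc Sp (conf0 Sp').
have [g eg] := conf_desc Sp' (conf0 Sp).
exists f => //; exists g; split.
  by apply: (conf_epi Sp); rewrite -comp_assoc ef eg comp_idl.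
by apply: (conf_epi Sp'); rewrite -comp_assoc eg ef comp_idl.
Qed.

(** The map induced by [p] and [0] is a cokernel of [i']: if [h] kills [i'], then [h \c b] kills [i]
    and descends along [p]. *)
Lemma pushout_conf X Y Z X' (i : Mor X Y) (p : Mor Y Z) (a : Mor X X') :
  S i p -> exists Y' (b : Mor Y Y') (i' : Mor X' Y') (p' : Mor Y' Z),
    [/\ S i' p', b \c i = i' \c a, p' \c b = p & is_pushout i a b i'].
Proof.
move=> Sip.
have [|Y' [b [i' [po hi']]]] := exact_pushout hS (i := i) a; first by exists Z, p.
have [e uni] := po.
have [|p' [[p'b p'i'] _]] := uni Z p 0; first by rewrite (conf0 Sip) comp0l.
exists Y', b, i', p'; split=> //.
apply: (cokernel_conf hi'); split=> // W h hi0.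
have [|u eu] := conf_desc (h := h \c b) Sip.
  by rewrite -comp_assoc e comp_assoc hi0 comp0l.
exists u; split.
  have [|w [_ hw]] := uni W (h \c b) (h \c i').
    by rewrite -!comp_assoc e.
  rewrite -(hw h) //; apply/esym/hw.
  by rewrite -!comp_assoc p'b p'i' comp0r.
by move=> v hv; apply: (conf_epi Sip); rewrite eu -hv -comp_assoc p'b.
Qed.

(** The map induced by [s] and [t] is first built on the pullback [Q] of [p] along [t], and then
    descended along the deflation [Q -> W]. *)
Lemma conf_mor_pullback X Y Z Y' Z' (i : Mor X Y) (p : Mor Y Z)
    (i' : Mor X Y') (p' : Mor Y' Z') (h : Mor Y Y') (c : Mor Z Z') :
  S i p -> S i' p' -> h \c i = i' -> p' \c h = c \c p -> is_pullback p' c h p.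
Proof.
move=> Sip Sip' hi ph; split=> // W s t st.
have [|Q [qY [qW [[eq _] [J [j Sj]]]]]] := exact_pullback hS (p := p) t.
  by exists X, i.
have [|v ev] := conf_lift (h := s \c qW - h \c qY) Sip'.
  by rewrite compBr !comp_assoc ph st -(comp_mid _ eq) subrr.
(* [h \c qY] and [s \c qW] differ by a map into the common kernel [X], which corrects [qY]. *)
pose g := qY + i \c v.
have hg : h \c g = s \c qW.
  by rewrite comp_addr comp_assoc hi ev addrC subrK.
have pg : p \c g = t \c qW.
  by rewrite comp_addr comp_assoc (conf0 Sip) comp0l addr0.
(* Joint monicity of [h] and [p] gives both the descent of [g] and uniqueness. *)
have inj W' (d : Mor W' Y) : h \c d = 0 -> p \c d = 0 -> d = 0.
  move=> hd /(conf_lift Sip) [w ew]; rewrite -ew in hd *.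
  by rewrite comp_assoc hi in hd; rewrite (conf_mono0 Sip' hd) comp0r.
have [|u eu] := conf_desc (h := g) Sj.
  apply: inj; first by rewrite comp_assoc hg -comp_assoc (conf0 Sj) comp0r.
  by rewrite comp_assoc pg -comp_assoc (conf0 Sj) comp0r.
have hu : h \c u = s.
  by apply: (conf_epi Sj); rewrite -comp_assoc eu.
have pu : p \c u = t.
  by apply: (conf_epi Sj); rewrite -comp_assoc eu.
exists u; split=> // u' [hu' pu']; apply/subr0_eq/inj.
  by rewrite compBr hu hu' subrr.
by rewrite compBr pu pu' subrr.
Qed.

(** By [conf_mor_pullback], [h] is a pullback of [idm Z], hence invertible. *)
Lemma short_five X Y Z Y' (i : Mor X Y) (p : Mor Y Z)
    (i' : Mor X Y') (p' : Mor Y' Z) (h : Mor Y Y') :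
  S i p -> S i' p' -> h \c i = i' -> p' \c h = p -> is_iso h.
Proof.
move=> Sip Sip' hi ph.
have pb : is_pullback p' (idm Z) h p.
  by apply: (conf_mor_pullback Sip Sip') => //; rewrite comp_idl.
have [_ /(_ Y' (idm Y') p')] := pb.
case=> [|u [[hu pu] _]]; first by rewrite comp_idl comp_idr.
exists u; split=> //; apply: (pullback_eq pb).
  by rewrite comp_assoc hu comp_idl comp_idr.
by rewrite comp_assoc pu comp_idr.
Qed.

(** [N] is the quotient of [Z] by [X], obtained as the pushout of [j] along [p]; the universal
    property of the pushout is that of a cokernel of [j \c i]. *)
Lemma inflation_comp_conf X Y Z Q R (i : Mor X Y) (p : Mor Y Q)
    (j : Mor Y Z) (q : Mor Z R) :
  S i p -> S j q -> exists N (r : Mor Z N) (m : Mor Q N) (n : Mor N R),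
    [/\ S (j \c i) r, S m n, r \c j = m \c p & n \c r = q].
Proof.
move=> Sip Sjq.
have [N [r [m [n [Smn e nr [_ uni]]]]]] := pushout_conf p Sjq.
exists N, r, m, n; split=> //.
apply: cokernel_conf; first by apply: (exact_comp_inflation hS); [exists Q, p|exists R, q].
split; first by rewrite comp_assoc e -comp_assoc (conf0 Sip) comp0r.
move=> W h; rewrite comp_assoc => /(conf_desc Sip) [u eu].
have [w [[wr wm] hw]] := uni W h u (esym eu).
exists w; split=> // w' w'r; apply: hw; split=> //.
by apply: (conf_epi Sip); rewrite -comp_assoc -e comp_assoc w'r eu.
Qed.

End ExactTheory.

(** * Dual statements, and pullbacks of inflations along deflations *)

Section ExactTheoryDual.
Variables (E : category) (S : pair_class E).
Hypothesis hS : exact_category S.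
Implicit Types X Y Z W : E.

Lemma kernel_conf X Y Z (i : Mor X Y) (p : Mor Y Z) :
  deflation S p -> is_kernel i p -> S i p.
Proof.
move=> hp hk; exact: (@cokernel_conf _ _ (exact_op hS) Z Y X p i hp hk).
Qed.

Lemma iso_deflation X Y (f : Mor X Y) : is_iso f -> deflation S f.
Proof.
by move=> /is_iso_op; apply: (iso_inflation (exact_op hS)).
Qed.

Lemma conf_isol X Y Z X' (i : Mor X Y) (p : Mor Y Z) (x : Mor X' X) :
  S i p -> is_iso x -> S (i \c x) p.
Proof.
by move=> h /is_iso_op; apply: (@conf_isor _ _ (exact_op hS) Z Y X X' p i x h).
Qed.

Lemma pullback_conf X Y Z Z' (i : Mor X Y) (p : Mor Y Z) (c : Mor Z' Z) :
  S i p -> exists Y' (i' : Mor X Y') (p' : Mor Y' Z') (b : Mor Y' Y),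
    [/\ S i' p', p \c b = c \c p', b \c i' = i & is_pullback p c b p'].
Proof.
move=> h; have [Y' [b [i' [p' [? ? ? ?]]]]] :=
  @pushout_conf _ _ (exact_op hS) Z Y X Z' p i c h.
by exists Y', p', i', b.
Qed.

Lemma conf_mor_pushout X Y Z X' Y' (i : Mor X Y) (p : Mor Y Z)
    (i' : Mor X' Y') (p' : Mor Y' Z) (h : Mor Y Y') (a : Mor X X') :
  S i p -> S i' p' -> p' \c h = p -> h \c i = i' \c a -> is_pushout i a h i'.
Proof.
by move=> h1 h2 h3 h4;
  apply: (@conf_mor_pullback _ _ (exact_op hS) Z Y' X' Y X p' i' p i h a).
Qed.

Lemma deflation_comp_conf X Y Z W K (i : Mor X Y) (p : Mor Y Z)
    (j : Mor K Z) (q : Mor Z W) :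
  S i p -> S j q -> exists N (n : Mor N Y) (m : Mor X N) (t : Mor N K),
    [/\ S n (q \c p), S m t, p \c n = j \c t & n \c m = i].
Proof.
move=> h1 h2; have [N [r [m [n [? ? ? ?]]]]] :=
  @inflation_comp_conf _ _ (exact_op hS) W Z Y K X q j p i h2 h1.
by exists N, r, n, m.
Qed.

(** [e] is the pullback of the inflation [i] along the deflation [d], hence a kernel of the
    deflation [p \c d]. *)
Lemma pullback_inflation A E1 K V E0 X (a : Mor A E1) (g : Mor E1 K)
    (a' : Mor A V) (d : Mor V E0) (e : Mor E1 V) (i : Mor K E0) (p : Mor E0 X) :
  S a g -> S a' d -> e \c a = a' -> d \c e = i \c g -> S i p -> S e (p \c d).
Proof.
move=> Sag Sad ea de Sip.
have [_ uni] := conf_mor_pullback hS Sag Sad ea de.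
apply: kernel_conf.
  by apply: (exact_comp_deflation hS); [exists A, a' | exists K, i].
split; first by rewrite -comp_assoc de comp_assoc (conf0 hS Sip) comp0l.
move=> W h; rewrite -comp_assoc => /(conf_lift hS Sip) [w ew].
have [u [[eu gu] hu]] := uni W h w (esym ew).
exists u; split=> // u' eu'; apply: hu; split=> //.
by apply: (conf_mono hS Sip); rewrite comp_assoc -de -comp_assoc eu' ew.
Qed.

Lemma is_pullback_conf X Y Z Y' Z' (i : Mor X Y) (p : Mor Y Z) (c : Mor Z' Z)
    (b : Mor Y' Y) (p' : Mor Y' Z') :
  is_pullback p c b p' -> S i p ->
  exists2 i' : Mor X Y', S i' p' & b \c i' = i.
Proof.
move=> pb /(pullback_conf c) [Y1 [i1 [p1 [b1 [S1 e1 bi1 pb1]]]]].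
have [e uni] := pb; have [_ uni1] := pb1.
have [u [[bu pu] _]] := uni _ b1 p1 e1.
have [v [[bv pv] _]] := uni1 _ b p' e.
exists (u \c i1); last by rewrite comp_assoc bu.
apply: (conf_iso hS (is_iso_id X) (y := u) _ (is_iso_id Z') _ _ S1).
- exists v; split; [apply: (pullback_eq pb1) | apply: (pullback_eq pb)].
  + by rewrite comp_assoc bv comp_idr.
  + by rewrite comp_assoc pv comp_idr.
  + by rewrite comp_assoc bu comp_idr.
  by rewrite comp_assoc pu comp_idr.
- by rewrite comp_idr.
by rewrite comp_idl pu.
Qed.

End ExactTheoryDual.

(** * Splitting and the obstruction groups [Ext^1], [Ext^2] *)

Section Splitting.
Variables (E : category) (S : pair_class E).
Hypothesis hS : exact_category S.
Implicit Types X Y Z W A : E.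

Lemma retraction_section X Y Z (i : Mor X Y) (p : Mor Y Z) (r : Mor Y X) :
  S i p -> r \c i = idm X -> exists s : Mor Z Y,
    [/\ p \c s = idm Z, r \c s = 0 & i \c r + s \c p = idm Y].
Proof.
move=> Sip ri; have [|s es] := conf_desc hS (h := idm Y - i \c r) Sip.
  by rewrite compBl comp_idl -comp_assoc ri comp_idr subrr.
exists s; split; last by rewrite es addrC subrK.
  apply: (conf_epi hS Sip); rewrite -comp_assoc es compBr comp_idr comp_assoc.
  by rewrite (conf0 hS Sip) comp0l subr0 comp_idl.
apply: (conf_epi0 hS Sip).
by rewrite -comp_assoc es compBr comp_idr comp_assoc ri comp_idl subrr.
Qed.

Lemma section_retraction X Y Z (i : Mor X Y) (p : Mor Y Z) (s : Mor Z Y) :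
  S i p -> p \c s = idm Z -> exists r : Mor Y X,
    [/\ r \c i = idm X, r \c s = 0 & i \c r + s \c p = idm Y].
Proof.
move=> Sip ps; have [|r er] := conf_lift hS (h := idm Y - s \c p) Sip.
  by rewrite compBr comp_idr comp_assoc ps comp_idl subrr.
exists r; split; last by rewrite er subrK.
  apply: (conf_mono hS Sip); rewrite comp_assoc er compBl comp_idl -comp_assoc.
  by rewrite (conf0 hS Sip) comp0r subr0 comp_idr.
apply: (conf_mono0 hS Sip).
by rewrite comp_assoc er compBl comp_idl -comp_assoc ps comp_idr subrr.
Qed.

Lemma biproduct_conf X Y (b : biproduct X Y) : S (bp_in1 b) (bp_pr2 b).
Proof.
(* Pulling back the conflation [X = X -> O] along [0 : Y -> O] produces a split extension of [Y] by
   [X], whose middle term is then compared with [b]. *)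
have [O [z Sz]] := exact_id_inflation hS X.
have [V [i [p [r [Sip _ ri _]]]]] := pullback_conf hS (0 : Mor Y O) Sz.
have [s [ps rs sum]] := retraction_section Sip ri.
have hh : is_iso (bp_in1 b \c r + bp_in2 b \c p).
  exists (i \c bp_pr1 b + s \c bp_pr2 b); split.
    rewrite comp_addl !comp_addr !comp_assoc -!(comp_assoc _ _ (bp_in1 b)).
    rewrite -!(comp_assoc _ _ (bp_in2 b)) bp_11 bp_12 bp_21 bp_22 !comp_idr.
    by rewrite !comp0r !comp0l addr0 add0r.
  rewrite comp_addl !comp_addr !comp_assoc -!(comp_assoc _ _ i).
  rewrite -!(comp_assoc _ _ s) ri rs ps (conf0 hS Sip) !comp_idr.
  by rewrite !comp0r !comp0l addr0 add0r bp_sum.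
apply: (conf_iso hS (is_iso_id X) hh (is_iso_id Y) _ _ Sip).
  rewrite comp_addl -!comp_assoc ri (conf0 hS Sip) comp0r addr0.
  by rewrite !comp_idr.
by rewrite comp_addr !comp_assoc bp_21 bp_22 comp0l add0r.
Qed.

Lemma split_conf X Y Z (i : Mor X Y) (p : Mor Y Z) (s : Mor Z Y) :
  S i p -> p \c s = idm Z -> exists r : Mor Y X,
    [/\ S s r, r \c i = idm X & i \c r + s \c p = idm Y].
Proof.
move=> Sip ps; have [r [ri rs sum]] := section_retraction Sip ps.
exists r; split=> //; rewrite addrC in sum.
exact: (biproduct_conf (Biproduct ps ri (conf0 hS Sip) rs sum)).
Qed.

Definition splits X A (s : ext S X A) := exists t, ext_def s \c t = idm X.

(** A section moves forward along a morphism of extensions and a retraction moves backward; each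
    yields the other. *)
Lemma ext_equiv_splits X A (s s' : ext S X A) :
  ext_equiv s s' -> (splits s <-> splits s').
Proof.
elim=> [{}s {}s' [h [hi ph]]|//|? ? _ [? ?]|? ? ? _ [? ?] _ [? ?]]; try by split; auto.
rewrite comp_idr in hi; rewrite comp_idl in ph; split=> [[t et]|[t et]].
  by exists (h \c t); rewrite comp_assoc ph.
have [r [ri _ _]] := section_retraction (ext_conf s') et.
have [|t' [pt' _ _]] := retraction_section (r := r \c h) (ext_conf s).
  by rewrite -comp_assoc hi.
by exists t'.
Qed.

(** The given extension is equivalent to a split one, the pullback of [A = A -> O] along a zero
    map. *)
Lemma Ext1_eq0_splits X A V (i : Mor A V) (p : Mor V X) :
  Ext1_eq0 S X A -> S i p -> exists s, p \c s = idm X.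
Proof.
move=> h0 Sip; have [O [z Sz]] := exact_id_inflation hS A.
have [V' [i' [p' [r [Sip' _ ri _]]]]] := pullback_conf hS (0 : Mor X O) Sz.
have [s [ps _ _]] := retraction_section Sip' ri.
have [_ h] := ext_equiv_splits (h0 (Extension Sip) (Extension Sip')).
by apply: h; exists s.
Qed.

Lemma splits_Ext1_eq0 X A :
  (forall V (i : Mor A V) (p : Mor V X), S i p -> exists s, p \c s = idm X) ->
  Ext1_eq0 S X A.
Proof.
move=> h [V i p Sip] [V' i' p' Sip']; apply: rst_step => /=.
have [s ps] := h _ _ _ Sip; have [s' ps'] := h _ _ _ Sip'.
have [r [ri _ _]] := section_retraction Sip ps.
exists (i' \c r + s' \c p) => /=; rewrite comp_addl comp_addr; split.
  by rewrite -!comp_assoc ri (conf0 hS Sip) comp0r addr0.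
by rewrite !comp_assoc (conf0 hS Sip') comp0l add0r ps'.
Qed.

Lemma Ext1_lift X A V Y (i : Mor A V) (p : Mor V Y) (f : Mor X Y) :
  Ext1_eq0 S X A -> S i p -> exists g, p \c g = f.
Proof.
move=> h0 Sip; have [V' [i' [p' [b [Sip' e _ _]]]]] := pullback_conf hS f Sip.
have [s ps] := Ext1_eq0_splits h0 Sip'.
by exists (b \c s); rewrite comp_assoc e -comp_assoc ps comp_idr.
Qed.

Lemma Ext1_extend X Y Z A (i : Mor X Y) (p : Mor Y Z) (f : Mor X A) :
  Ext1_eq0 S Z A -> S i p -> exists g, g \c i = f.
Proof.
move=> h0 Sip; have [V [b [i' [p' [Sip' e _ _]]]]] := pushout_conf hS f Sip.
have [s ps] := Ext1_eq0_splits h0 Sip'.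
have [r [ri _ _]] := section_retraction Sip' ps.
by exists (r \c b); rewrite -comp_assoc e comp_assoc ri comp_idl.
Qed.

(** Morphisms of extensions over identities are invertible by [short_five], so chains of them
    collapse to a single one. *)
Lemma ext_equiv_mor X A (s s' : ext S X A) :
  ext_equiv s s' -> ext_mor (idm A) (idm X) s s'.
Proof.
elim=> [//|{}s|{}s {}s' _ [h [hi ph]]|s1 s2 s3 _ [h [hi ph]] _ [h' [hi' ph']]].
- by exists (idm _); rewrite !comp_idl !comp_idr.
- rewrite comp_idr in hi; rewrite comp_idl in ph.
  have [g [gh hg]] := short_five hS (ext_conf s) (ext_conf s') hi ph.
  exists g; rewrite comp_idl comp_idr -hi -ph.
  by rewrite comp_assoc gh -comp_assoc hg comp_idl comp_idr.
exists (h' \c h); rewrite comp_assoc ph' -comp_assoc hi comp_assoc hi'.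
by rewrite -!comp_assoc ph !comp_idl comp_idr.
Qed.

(* Exactness at the middle of [Ext^1(U1,X) -> Ext^1(U0,X) -> Ext^1(T,X)]. *)
Lemma conf_quotient X Z0 U0 T U1 (i0 : Mor X Z0) (p0 : Mor Z0 U0)
    (f : Mor T U0) (q : Mor U0 U1) (j : Mor T Z0) :
  S i0 p0 -> S f q -> p0 \c j = f ->
  exists N (n : Mor Z0 N) (p1 : Mor N U1),
    [/\ S j n, S (n \c i0) p1 & p1 \c n = q \c p0].
Proof.
move=> Si0 Sf p0j.
(* [M] is the preimage of [T] in [Z0]. The map [j] splits the extension [X -> M -> T], and dividing
   by this copy of [T] leaves [X] as the kernel of [N -> U1]. *)
have [M [k [x [t [Sk Sx p0k kx]]]]] := deflation_comp_conf hS Si0 Sf.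
have [|s ks] := conf_lift hS (h := j) Sk.
  by rewrite -comp_assoc p0j (conf0 hS Sf).
have ts : t \c s = idm T.
  apply: (conf_mono hS Sf).
  by rewrite comp_assoc -p0k -comp_assoc ks p0j comp_idr.
have [r [Sr rx _]] := split_conf Sx ts.
have [N [n [m [p1 [Sn Sm nk p1n]]]]] := inflation_comp_conf hS Sr Sk.
rewrite ks in Sn; exists N, n, p1; split=> //.
by rewrite -kx comp_assoc nk -comp_assoc rx comp_idr.
Qed.

(* The vanishing of the class in [Ext^2] of the splice of [A -> E1 -> K] with a
   conflation [K -> E0 -> X], put in the form in which it is used. *)
Definition two_ext_lifts A E1 K E0 (a : Mor A E1) (g : Mor E1 K)
    (i : Mor K E0) :=
  exists V (a' : Mor A V) (d : Mor V E0) (e : Mor E1 V),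
    [/\ S a' d, e \c a = a' & d \c e = i \c g].

(** A lift for the second row is pulled back along [e0]; a lift for the first is pushed out along
    [e1]. So liftability depends only on the class of the two-extension. *)
Lemma two_ext_lifts_mor A X E1 K E0 E1' K' E0'
    (a : Mor A E1) (g : Mor E1 K) (i : Mor K E0) (p : Mor E0 X)
    (a' : Mor A E1') (g' : Mor E1' K') (i' : Mor K' E0') (p' : Mor E0' X)
    (e1 : Mor E1 E1') (k : Mor K K') (e0 : Mor E0 E0') :
  S a g -> S i p -> S a' g' -> S i' p' -> e1 \c a = a' -> g' \c e1 = k \c g ->
  e0 \c i = i' \c k -> p' \c e0 = p ->
  two_ext_lifts a g i <-> two_ext_lifts a' g' i'.
Proof.
move=> Sag Sip Sag' Sip' e1a ge1 e0i pe0.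
split=> [[V [a1 [d [e [Sad ea de]]]]]|[V' [a1 [d' [e' [Sad ea de]]]]]]; last first.
  have [V [a2 [d [b [Sd e ba pb]]]]] := pullback_conf hS e0 Sad.
  have [_ /(_ _ (e' \c e1) (i \c g))] := pb.
  case=> [|u [[bu du] _]].
    by rewrite !comp_assoc de e0i -comp_assoc ge1 comp_assoc.
  exists V, a2, d, u; split=> //; apply: (pullback_eq pb).
    by rewrite comp_assoc bu ba -comp_assoc e1a.
  by rewrite comp_assoc du -comp_assoc (conf0 hS Sag) (conf0 hS Sd) comp0r.
have Se := pullback_inflation hS Sag Sad ea de Sip.
have [V' [v [e' [q' [Se' ve q'v po]]]]] := pushout_conf hS e1 Se.
(* [N] is [V'] modulo [A]. Like [E0'] it is an extension of [X] by [K']; [short_five] identifies the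
   two, which makes [d'] a cokernel of [A -> V']. *)
have [N [r [m [n [Sr Sm re nr]]]]] := inflation_comp_conf hS Sag' Se'.
have [_ uni] := po.
have [|d' [[d'v d'e'] _]] := uni _ (e0 \c d) (i' \c g').
  by rewrite -!comp_assoc de ge1 !comp_assoc e0i.
have [|w wr] := conf_desc hS (h := d') Sr.
  by rewrite comp_assoc d'e' -comp_assoc (conf0 hS Sag') comp0r.
have hw : is_iso w.
  apply: (short_five hS Sm Sip').
    by apply: (conf_epi hS Sag'); rewrite -comp_assoc -re comp_assoc wr.
  apply: (conf_epi hS Sr); rewrite -comp_assoc wr nr.
  have [|z [_ hz]] := uni _ (p \c d) 0.
    by rewrite comp0l (conf0 hS Se).
  rewrite -(hz (p' \c d')) ?(hz q') //; first by rewrite (conf0 hS Se').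
  rewrite -!comp_assoc d'v d'e' !comp_assoc pe0; split=> //.
  by rewrite (conf0 hS Sip') comp0l.
exists V', (e' \c a'), d', e'; split=> //.
by rewrite -wr; apply: conf_isor.
Qed.

Definition yext2_lifts X A (s : yext S 1 X A) :=
  two_ext_lifts (ext_inf (projT2 s).2) (ext_def (projT2 s).2)
    (ext_inf (projT2 s).1).

Lemma yext2_lifts_equiv X A (s s' : yext S 1 X A) :
  yext_equiv s s' -> (yext2_lifts s <-> yext2_lifts s').
Proof.
elim=> [{}s {}s'|//|? ? _ [? ?]|? ? ? _ [? ?] _ [? ?]]; try by split; auto.
move: s s' => [K [s0 s1]] [K' [s0' s1']] [k /= [[e0 [h1 h2]] [e1 [h3 h4]]]].
rewrite /yext2_lifts /=.
rewrite comp_idl in h2; rewrite comp_idr in h3.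
exact: (two_ext_lifts_mor (ext_conf s1) (ext_conf s0) (ext_conf s1')
  (ext_conf s0') h3 h4 h1 h2).
Qed.

Lemma Ext2_lift X A E1 K E0 (a : Mor A E1) (g : Mor E1 K)
    (i : Mor K E0) (p : Mor E0 X) :
  Ext2_eq0 S X A -> S a g -> S i p -> two_ext_lifts a g i.
Proof.
move=> h0 Sag Sip.
(* A two-extension that lifts by construction: [O' -> X = X], preceded by the pullback to [O'] of a
   split extension [V] of [X] by [A]. The given one is equivalent to it. *)
have [O [z Sz]] := exact_id_inflation hS A.
have [V [a' [d [r [Sad _ _ _]]]]] := pullback_conf hS (0 : Mor X O) Sz.
have [O' [z' Sz']] := exact_id_deflation hS X.
have [E1' [a1 [g1 [b [S1 eb ba _]]]]] := pullback_conf hS z' Sad.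
pose s : yext S 1 X A := existT _ K (Extension Sip, Extension Sag).
pose t : yext S 1 X A := existT _ O' (Extension Sz', Extension S1).
have [_ h] := yext2_lifts_equiv (h0 s t).
by apply: h; exists V, a', d, b.
Qed.

End Splitting.

(** * Exact structures on extension-closed subcategories and along equivalences *)

Section ExtensionClosed.
Variables (E : category) (S : pair_class E) (P : E -> Prop) (O : E).
Hypothesis hS : exact_category S.
Hypothesis hP : extension_closed S P.
Hypotheses (hO : zero_object O) (PO : P O).

Lemma zero_cokernel_conf (X Y : E) (f : Mor X Y) :
  is_iso f -> S f (0 : Mor Y O).
Proof.
move=> hf; apply: (cokernel_conf hS (iso_inflation hS hf)).
split=> [|W h hf0]; first by rewrite comp0l.
exists 0; split; first by rewrite comp0r; apply: (iso_epi hf); rewrite hf0 comp0l.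
by move=> u _; have [_ h0] := hO W; rewrite (h0 u).
Qed.

Lemma zero_kernel_conf (X Y : E) (f : Mor X Y) :
  is_iso f -> S (0 : Mor O X) f.
Proof.
move=> hf; apply: (kernel_conf hS (iso_deflation hS hf)).
split=> [|W h hf0]; first by rewrite comp0r.
exists 0; split; first by rewrite comp0l; apply: (iso_mono hf); rewrite hf0 comp0r.
by move=> u _; have [h0 _] := hO W; rewrite (h0 u).
Qed.

(** Each new object asked for by the axioms is an extension of two objects of [P]: a biproduct, the
    cokernel or kernel of a composite, the corner of a pushout or pullback. [O] serves the
    identities. *)
Lemma extension_closed_exact : exact_category (@sub_class E S P).
Proof.
have [_ hsum] := exact_additive hS.
split.
- split; first by exists (exist _ O PO) => X; apply: hO.
  move=> [X PX] [Y PY]; have [b] := hsum X Y.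
  have Pb : P b := hP (biproduct_conf hS b) PX PY.
  constructor; exact: (@Biproduct (full_sub P) (exist _ X PX) (exist _ Y PY)
    (exist _ (bp_ob b) Pb) (bp_in1 b) (bp_in2 b) (bp_pr1 b) (bp_pr2 b)
    (bp_11 b) (bp_22 b) (bp_12 b) (bp_21 b) (bp_sum b)).
- move=> X Y Z i p Sip; have [[e1 h1] [e2 h2]] := exact_ker_coker hS Sip.
  by split; split=> // W h; [apply: h1 | apply: h2].
- move=> X Y Z X' Y' Z' i p i' p' [x [y [z [hx hy hz e1 e2]]]] Sip.
  exact: (conf_iso hS hx hy hz e1 e2 Sip).
- by move=> X; exists (exist _ O PO), 0; apply/zero_cokernel_conf/is_iso_id.
- by move=> X; exists (exist _ O PO), 0; apply/zero_kernel_conf/is_iso_id.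
- move=> X Y Z j i [[Q PQ] [p Sp]] [[R PR] [q Sq]].
  have [N [r [m [n [Sr Sm _ _]]]]] := inflation_comp_conf hS Sp Sq.
  by exists (exist _ N (hP Sm PQ PR)), r.
- move=> X Y Z q p [[K PK] [i Si]] [[L PL] [j Sj]].
  have [N [r [m [n [Sr Sm _ _]]]]] := deflation_comp_conf hS Si Sj.
  by exists (exist _ N (hP Sm PK PL)), r.
- move=> X Y [X' PX'] i a [[Q PQ] [p Sp]].
  have [Y' [b [i' [p' [Si' _ _ [e h]]]]]] := pushout_conf hS a Sp.
  exists (exist _ Y' (hP Si' PX' PQ)), b, i'; split; last by exists (exist _ Q PQ), p'.
  by split=> // W; apply: h.
move=> Y Z [Z' PZ'] p c [[K PK] [i Si]].
have [Y' [i' [p' [b [Si' _ _ [e h]]]]]] := pullback_conf hS c Si.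
exists (exist _ Y' (hP Si' PK PZ')), b, p'; split; last by exists (exist _ K PK), i'.
by split=> // W; apply: h.
Qed.

End ExtensionClosed.

Section Functoriality.
Variables (C D : category) (G : functor C D).

Lemma fmap0 X Y : fmap G (0 : Mor X Y) = 0.
Proof. by apply: (addrI (fmap G 0)); rewrite -fmap_add !addr0. Qed.

Lemma fmap_opp X Y (f : Mor X Y) : fmap G (- f) = - fmap G f.
Proof. by apply: (addrI (fmap G f)); rewrite -fmap_add !subrr fmap0. Qed.

Lemma fmap_iso X Y (f : Mor X Y) : is_iso f -> is_iso (fmap G f).
Proof.
by move=> [g [gf fg]]; exists (fmap G g); rewrite -!fmap_comp gf fg !fmap_id.
Qed.

Lemma fmap_iso_pairs X Y Z X' Y' Z' (i : Mor X Y) (p : Mor Y Z)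
    (i' : Mor X' Y') (p' : Mor Y' Z') :
  iso_pairs i p i' p' ->
  iso_pairs (fmap G i) (fmap G p) (fmap G i') (fmap G p').
Proof.
move=> [x [y [z [hx hy hz e1 e2]]]]; exists (fmap G x), (fmap G y), (fmap G z).
by split; rewrite -?fmap_comp ?e1 ?e2 //; apply: fmap_iso.
Qed.

Program Definition fmap_biproduct X Y (b : biproduct X Y) :
    biproduct (G X) (G Y) :=
  @Biproduct D (G X) (G Y) (G b) (fmap G (bp_in1 b)) (fmap G (bp_in2 b))
    (fmap G (bp_pr1 b)) (fmap G (bp_pr2 b)) _ _ _ _ _.
Next Obligation. by rewrite -fmap_comp bp_11 fmap_id. Qed.
Next Obligation. by rewrite -fmap_comp bp_22 fmap_id. Qed.
Next Obligation. by rewrite -fmap_comp bp_12 fmap0. Qed.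
Next Obligation. by rewrite -fmap_comp bp_21 fmap0. Qed.
Next Obligation. by rewrite -!fmap_comp -fmap_add bp_sum fmap_id. Qed.

Variables (S : pair_class C) (T : pair_class D) (hG : exact_functor S T G).

Lemma ext_mor_map X A X' A' (a : Mor A A') (x : Mor X X')
    (s : ext S X A) (s' : ext S X' A') :
  ext_mor a x s s' ->
  ext_mor (fmap G a) (fmap G x) (ext_map hG s) (ext_map hG s').
Proof.
by move=> [h [e1 e2]]; exists (fmap G h) => /=; rewrite -!fmap_comp e1 e2.
Qed.

Lemma ext_equiv_map X A (s s' : ext S X A) :
  ext_equiv s s' -> ext_equiv (ext_map hG s) (ext_map hG s').
Proof.
elim=> [{}s {}s' /ext_mor_map h|{}s|{}s {}s' _ h|s1 s2 s3 _ h1 _ h2].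
- by apply: rst_step; rewrite !fmap_id in h.
- exact: rst_refl.
- exact: rst_sym.
exact: rst_trans h2.
Qed.

Lemma baer_sum_map X A (s1 s2 s3 : ext S X A) :
  baer_sum s1 s2 s3 ->
  baer_sum (ext_map hG s1) (ext_map hG s2) (ext_map hG s3).
Proof.
move=> [AA [XX [t [w [/ext_mor_map h1 /ext_mor_map h2 /ext_mor_map h3]]]]].
move=> /ext_mor_map h4; rewrite !fmap_id !fmap_add in h3 h4.
exists (fmap_biproduct AA), (fmap_biproduct XX), (ext_map hG t), (ext_map hG w).
by split.
Qed.

End Functoriality.

(** * Transport of exact structures along a full, faithful and dense functor *)

Section Transport.
Variables (C D : category) (G : functor C D).
Hypothesis G_full :
  forall (X Y : C) (g : Mor (G X) (G Y)), exists f, fmap G f = g.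
Hypothesis G_faithful : forall (X Y : C) (f : Mor X Y), fmap G f = 0 -> f = 0.
Hypothesis G_dense : dense G.

Lemma faithful_inj X Y (f g : Mor X Y) : fmap G f = fmap G g -> f = g.
Proof.
by move=> e; apply/subr0_eq/G_faithful; rewrite fmap_add fmap_opp e subrr.
Qed.

Lemma full_faithful_iso X Y (g : Mor (G X) (G Y)) :
  is_iso g -> exists2 f : Mor X Y, is_iso f & fmap G f = g.
Proof.
move=> [g' [g'g gg']]; have [f ef] := G_full g; have [f' ef'] := G_full g'.
exists f => //; exists f'; split; apply: faithful_inj.
  by rewrite fmap_comp ef ef' fmap_id.
by rewrite fmap_comp ef ef' fmap_id.
Qed.

Lemma full_faithful_dense_equivalence : equivalence G.
Proof.
(* The quasi-inverse is data, so objects, isomorphisms and preimages of morphisms are picked by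
   [cid]. The chosen [e] form one of the natural isomorphisms, and their preimages at [G X] the
   other. *)
have hd Y : {X : C & {e : Mor (G X) Y | is_iso e}}.
  by have [X /cid hX] := cid (G_dense Y); exists X.
pose ob Y := projT1 (hd Y); pose e Y : Mor (G (ob Y)) Y := sval (projT2 (hd Y)).
have e_iso Y : is_iso (e Y) := proj2_sig (projT2 (hd Y)).
have hinv Y : {e' : Mor Y (G (ob Y)) | e' \c e Y = idm _ /\ e Y \c e' = idm Y}.
  exact/cid/e_iso.
pose e' Y : Mor Y (G (ob Y)) := sval (hinv Y).
have e'e Y : e' Y \c e Y = idm _ by have [] := proj2_sig (hinv Y).
have ee' Y : e Y \c e' Y = idm _ by have [] := proj2_sig (hinv Y).
have hm Y Y' (g : Mor Y Y') :
  {f : Mor (ob Y) (ob Y') | fmap G f = e' Y' \c g \c e Y} by exact/cid/G_full.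
pose mor Y Y' (g : Mor Y Y') : Mor (ob Y) (ob Y') := sval (hm Y Y' g).
have emor Y Y' (g : Mor Y Y') : fmap G (mor _ _ g) = e' Y' \c g \c e Y :=
  proj2_sig (hm Y Y' g).
have mor_id Y : mor _ _ (idm Y) = idm (ob Y).
  by apply: faithful_inj; rewrite emor fmap_id comp_idr e'e.
have mor_comp X Y Z (g : Mor Y Z) (f : Mor X Y) :
    mor _ _ (g \c f) = mor _ _ g \c mor _ _ f.
  apply: faithful_inj; rewrite fmap_comp !emor !comp_assoc.
  by rewrite -(comp_assoc _ (e Y)) ee' comp_idr.
have mor_add X Y (f g : Mor X Y) : mor _ _ (f + g) = mor _ _ f + mor _ _ g.
  by apply: faithful_inj; rewrite fmap_add !emor comp_addr comp_addl.
exists (Functor mor_id mor_comp mor_add); split; last first.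
  exists e; split=> // X Y f /=.
  by rewrite emor !comp_assoc ee' comp_idl.
have hn X : {n : Mor (ob (G X)) X | is_iso n /\ fmap G n = e (G X)}.
  by apply/cid; have [n ? ?] := full_faithful_iso (e_iso (G X)); exists n.
exists (fun X => sval (hn X)); split=> [X|X Y f] /=.
  by have [] := proj2_sig (hn X).
apply: faithful_inj; rewrite !fmap_comp emor.
rewrite (proj2 (proj2_sig (hn X))) (proj2 (proj2_sig (hn Y))).
by rewrite !comp_assoc ee' comp_idl.
Qed.

Variables (S : pair_class C) (T : pair_class D).
Hypothesis hT : exact_category T.
Hypothesis hST : forall X Y Z (i : Mor X Y) (p : Mor Y Z),
  S i p <-> T (fmap G i) (fmap G p).

Lemma preimage_exact_functor : exact_functor S T G.
Proof. by move=> X Y Z i p /hST. Qed.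

Lemma preimage_inflation X Y (i : Mor X Y) :
  inflation T (fmap G i) -> inflation S i.
Proof.
move=> [Z [p Tp]]; have [Z' [e he]] := G_dense Z.
have [e' hee'] := he; have [p' ep'] := G_full (e' \c p).
exists Z', p'; apply/hST; rewrite ep'; apply: (conf_isor hT Tp).
by exists e; split; case: hee'.
Qed.

Lemma preimage_deflation Y Z (p : Mor Y Z) :
  deflation T (fmap G p) -> deflation S p.
Proof.
move=> [X [i Ti]]; have [X' [e he]] := G_dense X.
have [i' ei'] := G_full (i \c e).
by exists X', i'; apply/hST; rewrite ei'; apply: (conf_isol hT Ti).
Qed.

Lemma inflation_map X Y (i : Mor X Y) : inflation S i -> inflation T (fmap G i).
Proof. by move=> [Z [p /hST]]; exists (G Z), (fmap G p). Qed.

Lemma deflation_map X Y (i : Mor X Y) : deflation S i -> deflation T (fmap G i).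
Proof. by move=> [Z [p /hST]]; exists (G Z), (fmap G p). Qed.

Lemma preimage_additive : additive_category C.
Proof.
have [[Z hZ] hsum] := exact_additive hT.
split.
  have [Z' [e he]] := G_dense Z; have [e' [e'e ee']] := he.
  exists Z' => X; have [h1 h2] := hZ (G X); split=> f; apply: G_faithful.
    by apply: (iso_mono he); rewrite comp0r.
  rewrite -(comp_idr (fmap G f)) -e'e comp_assoc.
  by rewrite (h2 (fmap G f \c e')) comp0l.
move=> X Y; have [b] := hsum (G X) (G Y).
have [P [e [e' [e'e ee']]]] := G_dense (bp_ob b).
have [i1 ei1] := G_full (e' \c bp_in1 b); have [i2 ei2] := G_full (e' \c bp_in2 b).
have [p1 ep1] := G_full (bp_pr1 b \c e); have [p2 ep2] := G_full (bp_pr2 b \c e).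
constructor; apply: (@Biproduct C X Y P i1 i2 p1 p2); apply: faithful_inj;
  rewrite ?fmap_add !fmap_comp ?ei1 ?ei2 ?ep1 ?ep2 ?fmap_id ?fmap0 ?comp_assoc;
  rewrite -1?(comp_assoc _ e e') ?ee' ?comp_idr ?bp_11 ?bp_12 ?bp_21 ?bp_22 //.
by rewrite -comp_addl -!(comp_assoc e') -comp_addr bp_sum comp_idr e'e.
Qed.

Lemma full_faithful_pushout X Y X' Y' (i : Mor X Y) (a : Mor X X')
    (b : Mor Y Y') (i' : Mor X' Y') :
  is_pushout (fmap G i) (fmap G a) (fmap G b) (fmap G i') ->
  is_pushout i a b i'.
Proof.
move=> [e uni]; split=> [|W s t st].
  by apply: faithful_inj; rewrite !fmap_comp.
have [|u [[us ut] hu]] := uni (G W) (fmap G s) (fmap G t).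
  by rewrite -!fmap_comp st.
have [v ev] := G_full u; exists v; split.
  by split; apply: faithful_inj; rewrite fmap_comp ev.
move=> v' [v's v't]; apply: faithful_inj; rewrite ev; apply: hu.
by rewrite -!fmap_comp v's v't.
Qed.

Lemma full_faithful_pullback Y Z Y' Z' (p : Mor Y Z) (c : Mor Z' Z)
    (b : Mor Y' Y) (p' : Mor Y' Z') :
  is_pullback (fmap G p) (fmap G c) (fmap G b) (fmap G p') ->
  is_pullback p c b p'.
Proof.
move=> [e uni]; split=> [|W s t st].
  by apply: faithful_inj; rewrite !fmap_comp.
have [|u [[us ut] hu]] := uni (G W) (fmap G s) (fmap G t).
  by rewrite -!fmap_comp st.
have [v ev] := G_full u; exists v; split.
  by split; apply: faithful_inj; rewrite fmap_comp ev.
move=> v' [v's v't]; apply: faithful_inj; rewrite ev; apply: hu.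
by rewrite -!fmap_comp v's v't.
Qed.

Lemma full_faithful_ker_coker X Y Z (i : Mor X Y) (p : Mor Y Z) :
  ker_coker_pair (fmap G i) (fmap G p) -> ker_coker_pair i p.
Proof.
move=> [[e k] [_ c]].
have pi0 : p \c i = 0 by apply: G_faithful; rewrite fmap_comp.
split; split=> // W h h0.
  have [|u [hu uniq]] := k (G W) (fmap G h); first by rewrite -fmap_comp h0 fmap0.
  have [v ev] := G_full u; exists v; split.
    by apply: faithful_inj; rewrite fmap_comp ev.
  by move=> v' hv'; apply: faithful_inj; rewrite ev; apply: uniq; rewrite -fmap_comp hv'.
have [|u [hu uniq]] := c (G W) (fmap G h); first by rewrite -fmap_comp h0 fmap0.
have [v ev] := G_full u; exists v; split.
  by apply: faithful_inj; rewrite fmap_comp ev.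
by move=> v' hv'; apply: faithful_inj; rewrite ev; apply: uniq; rewrite -fmap_comp hv'.
Qed.

(** [S] is the preimage of [T], and [G] reflects kernels, cokernels, pushouts and pullbacks, so
    every axiom is checked in [D]. *)
Lemma preimage_exact : exact_category S.
Proof.
split.
- exact: preimage_additive.
- by move=> X Y Z i p /hST /(exact_ker_coker hT) /full_faithful_ker_coker.
- move=> X Y Z X' Y' Z' i p i' p' /(fmap_iso_pairs G) h /hST Tip.
  exact/hST/(exact_iso hT h Tip).
- by move=> X; apply: preimage_inflation; rewrite fmap_id; apply: exact_id_inflation.
- by move=> X; apply: preimage_deflation; rewrite fmap_id; apply: exact_id_deflation.
- move=> X Y Z j i /inflation_map hi /inflation_map hj.
  by apply: preimage_inflation; rewrite fmap_comp; apply: exact_comp_inflation.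
- move=> X Y Z j i /deflation_map hi /deflation_map hj.
  by apply: preimage_deflation; rewrite fmap_comp; apply: exact_comp_deflation.
- move=> X Y X' i a [Z [p /hST Tip]].
  have [V [b [i' [p' [Ti' e p'b [_ uni]]]]]] := pushout_conf hT (fmap G a) Tip.
  (* The corner [V] formed in [D] is replaced by an isomorphic [G Y']. The new square is again a
     pushout, since it is a morphism of conflations over the identity of [G Z]. *)
  have [Y' [v hv]] := G_dense V; have [v' [v'v vv']] := hv.
  have [b1 eb1] := G_full (v' \c b); have [i1 ei1] := G_full (v' \c i').
  have [p1 ep1] := G_full (p' \c v).
  have Si1 : S i1 p1.
    apply/hST/(conf_iso hT (is_iso_id _) _ (is_iso_id _) _ _ Ti').
    + by exists v; split; first exact: vv'; exact: v'v.
    + by rewrite ei1 comp_idr.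
    by rewrite ep1 -comp_assoc vv' comp_idl comp_idr.
  exists Y', b1, i1; split; last by exists Z, p1.
  apply: full_faithful_pushout; apply: (conf_mor_pushout hT Tip).
  + exact/hST/Si1.
  + by rewrite ep1 eb1 comp_assoc -(comp_assoc _ v) vv' comp_idr.
  by rewrite eb1 ei1 -!comp_assoc e.
move=> Y Z Z' p c [X [i /hST Tip]].
have [V [i' [p' [b [Ti' e bi' [_ uni]]]]]] := pullback_conf hT (fmap G c) Tip.
have [Y' [v hv]] := G_dense V; have [v' [v'v vv']] := hv.
have [b1 eb1] := G_full (b \c v); have [i1 ei1] := G_full (v' \c i').
have [p1 ep1] := G_full (p' \c v).
have Si1 : S i1 p1.
  apply/hST/(conf_iso hT (is_iso_id _) _ (is_iso_id _) _ _ Ti').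
  + by exists v; split; first exact: vv'; exact: v'v.
  + by rewrite ei1 comp_idr.
  by rewrite ep1 -comp_assoc vv' comp_idl comp_idr.
exists Y', b1, p1; split; last by exists X, i1.
apply: full_faithful_pullback; apply: (conf_mor_pullback hT _ Tip).
+ exact/hST/Si1.
+ by rewrite ei1 eb1 comp_assoc -(comp_assoc _ v) vv' comp_idr.
by rewrite eb1 ep1 !comp_assoc e.
Qed.

(** By [ext_equiv_mor] an equivalence in [D] is one morphism, which lifts by fullness; an extension
    in [D] lifts once its middle term is replaced by an object in the image of [G]. *)
Lemma preimage_Ext1_iso : Ext1_iso preimage_exact_functor.
Proof.
move=> X A; split=> [s s'|[V i p Tip]|s1 s2 s3].
- split=> [/(ext_equiv_mor hT) [h [h1 h2]]|]; last exact: ext_equiv_map.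
  have [g eg] := G_full h; apply: rst_step; exists g.
  split; apply: faithful_inj; rewrite !fmap_comp eg fmap_id.
    exact: h1.
  exact: h2.
- have [V' [v hv]] := G_dense V; have [v' [v'v vv']] := hv.
  have [i1 ei1] := G_full (v' \c i); have [p1 ep1] := G_full (p \c v).
  have Si1 : S i1 p1.
    apply/hST/(conf_iso hT (is_iso_id _) _ (is_iso_id _) _ _ Tip).
    + by exists v; split; first exact: vv'; exact: v'v.
    + by rewrite ei1 comp_idr.
    by rewrite ep1 -comp_assoc vv' comp_idl comp_idr.
  exists (Extension Si1); apply: rst_step; exists v => /=.
  by rewrite ei1 ep1 comp_assoc vv' comp_idl comp_idr comp_idl.
exact: baer_sum_map.
Qed.

End Transport.

(** * Torsion pairs *)

(* The torsion pairs need not consist of isomorphism-closed subcategories. *)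
Definition iso_closure (E : category) (B : E -> Prop) (X : E) :=
  exists2 Y, B Y & isomorphic X Y.

Section TorsionPairs.
Variables (E : category) (S : pair_class E) (A B C : E -> Prop).
Hypotheses (hS : exact_category S) (hAB : torsion_pair S A B).
Hypothesis hC : forall X, C X <-> (forall Y, B Y -> forall f : Mor Y X, f = 0).
Implicit Types X Y Z W : E.

Notation B' := (iso_closure B).

(** For the torsion pair this is the isomorphism closure of [A], in a form visibly stable under
    extensions. *)
Definition perp_left X := forall Y, B Y -> forall f : Mor X Y, f = 0.

Lemma iso_closure_self X : B X -> B' X.
Proof. by move=> BX; exists X => //; apply: isomorphic_refl. Qed.

Lemma torsion_perp_left X : A X -> perp_left X.
Proof. by move=> AX Y BY f; apply: (proj1 hAB). Qed.

Lemma perp_left_hom0 X Y (f : Mor X Y) : perp_left X -> B' Y -> f = 0.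
Proof.
move=> hX [Z BZ [e he]]; apply: (iso_mono he).
by rewrite (hX _ BZ (e \c f)) comp0r.
Qed.

Lemma hom0_C X Y (f : Mor X Y) : B' X -> C Y -> f = 0.
Proof.
move=> [Z BZ /isomorphic_sym [e he]] /hC CY; apply: (iso_epi he).
by rewrite (CY _ BZ (f \c e)) comp0l.
Qed.

(** The torsion part of [Y] maps to it by zero, so the deflation onto its [B]-term is invertible. *)
Lemma perp_right_B Y : (forall X, A X -> forall f : Mor X Y, f = 0) -> B' Y.
Proof.
move=> hY; have [X [Z [i [p [AX BZ Sip]]]]] := proj2 hAB Y.
exists Z => //; exists p.
have [|u up] := conf_desc hS (h := idm Y) Sip.
  by rewrite (hY _ AX i) comp0r.
exists u; split=> //; apply: (conf_epi hS Sip).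
by rewrite -comp_assoc up comp_idl comp_idr.
Qed.

Lemma B_extension X Y Z (i : Mor X Y) (p : Mor Y Z) :
  S i p -> B' X -> B' Z -> B' Y.
Proof.
move=> Sip BX BZ; apply: perp_right_B => W /torsion_perp_left AW f.
have [|u <-] := conf_lift hS (h := f) Sip; first exact: perp_left_hom0.
by rewrite (perp_left_hom0 u AW BX) comp0r.
Qed.

Lemma B_sub X Y (f : Mor X Y) : mono f -> B' Y -> B' X.
Proof.
move=> mf BY; apply: perp_right_B => W /torsion_perp_left AW g.
by apply: mf; rewrite comp0r; apply: perp_left_hom0.
Qed.

Lemma C_sub X Y (f : Mor X Y) : mono f -> C Y -> C X.
Proof.
move=> mf /hC CY; apply/hC => W BW g.
by apply: mf; rewrite comp0r; apply: CY.
Qed.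

Lemma C_extension : extension_closed S C.
Proof.
move=> X Y Z i p Sip /hC CX /hC CZ; apply/hC => W BW f.
have [|u <-] := conf_lift hS (h := f) Sip; first exact: CZ.
by rewrite (CX _ BW u) comp0r.
Qed.

Lemma perp_left_extension : extension_closed S perp_left.
Proof.
move=> X Y Z i p Sip hX hZ W BW f.
have [|u <-] := conf_desc hS (h := f) Sip; first exact: hX.
by rewrite (hZ _ BW u) comp0l.
Qed.

End TorsionPairs.

(** * The objects [U^A] and the functor [F] *)

Section Setting.
Variables (E : category) (S : pair_class E) (A B C : E -> Prop).
Hypotheses (hS : exact_category S).
Hypotheses (hAB : torsion_pair S A B) (hBC : torsion_pair S B C).
Hypothesis hC : forall X, C X <-> (forall Y, B Y -> forall f : Mor Y X, f = 0).
Variables (F : functor E (full_sub B)) (hF : adjunction F (incl B)).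
Hypothesis hBab : abelian_category (full_sub B).
Hypothesis hBcompat : forall (X Y Z : full_sub B) (i : Mor X Y) (p : Mor Y Z),
  ker_coker_pair i p <-> sub_class S i p.
Hypothesis hfg : forall X, A X -> C X -> Ext1_finitely_generated S B X.
Implicit Types X Y Z W U V K : E.

Notation B' := (iso_closure B).
Notation A' := (perp_left B).
Notation L := (comp_functor (incl B) F).
Notation CU := (CU_sequence S B C).

(** In an abelian category a monomorphism is a kernel of some map, hence of its cokernel;
    compatibility turns this sequence into a conflation. *)
Lemma B_literal_mono_conf (Y Z : full_sub B) (f : Mor Y Z) :
  mono f -> exists (Q : full_sub B) (q : Mor Z Q), sub_class S f q.
Proof.
have [_ _ coker mono_ker _] := hBab.
move=> mf; have [Q [q cq]] := coker _ _ f; exists Q, q; apply/hBcompat.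
split=> //; have [R [r [rf0 kr]]] := mono_ker _ _ f mf.
have [qf0 uq] := cq; split=> // W h qh.
by have [u [ur _]] := uq _ r rf0; apply: kr; rewrite -ur -comp_assoc qh comp0r.
Qed.

(** The version for the isomorphism closure. Monicity is tested against objects of [B] only, where
    vanishing of maps into [C] can be used. *)
Lemma B_mono_conf Y Z (f : Mor Y Z) :
  B' Y -> B' Z -> (forall W, B W -> forall g : Mor W Y, f \c g = 0 -> g = 0) ->
  exists Q (q : Mor Z Q), B Q /\ S f q.
Proof.
move=> [Y0 BY [y hy]] [Z0 BZ [z hz]] mf.
have [y' [y'y yy']] := hy; have [z' [z'z zz']] := hz.
have [|[Q BQ] [q Sq]] := @B_literal_mono_conf (exist _ Y0 BY) (exist _ Z0 BZ)
    (z \c f \c y' : @Mor E Y0 Z0).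
  apply: mono0 => -[W BW] /= g e; apply: (iso_mono (f := y')); first by exists y.
  rewrite comp0r; apply: (mf _ BW); apply: (iso_mono hz).
  by rewrite comp0r !comp_assoc.
pose q' : @Mor E Z0 Q := q; exists Q, (q' \c z); split=> //.
apply: (conf_iso hS (x := y') (y := z') (z := idm Q) _ _ (is_iso_id Q) _ _ Sq).
- by exists y.
- by exists z.
- by rewrite !comp_assoc z'z comp_idl.
by rewrite comp_idl -comp_assoc zz' comp_idr.
Qed.

(** By Yoneda, [phi] is determined by the class [s0] of the identity of [U], and its surjectivity
    says that every extension is a pullback of [s0]. *)
Lemma versal_extension X : A X -> C X ->
  exists Z U (i : Mor X Z) (p : Mor Z U), [/\ B U, S i p
    & forall Y V (a : Mor X V) (d : Mor V Y), B' Y -> S a d ->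
        exists h : Mor V Z, h \c a = i].
Proof.
move=> AX CX; have [M [[theta [_ surj act _]] [U [phi epi_phi]]]] := hfg AX CX.
pose s0 := theta U (phi U (idm U)).
exists (ext_mid s0), (sval U), (ext_inf s0), (ext_def s0).
split; [exact: (proj2_sig U) | exact: ext_conf |].
move=> Y V a d [Y0 BY [e he]] Sad.
pose s := Extension (conf_isor hS Sad he).
have [m sm] := surj (exist _ Y0 BY) s.
have [f em] := epi_phi _ m.
rewrite -em -[f](comp_idl f) (_ : phi _ _ = mod_act M f (phi U (idm U))) in sm.
  have [h [h1 _]] := act _ _ f (phi U (idm U)).
  have [h' [h1' _]] := ext_equiv_mor hS (rst_sym _ _ _ _ sm).
  rewrite comp_idr in h1; rewrite comp_idr in h1'.
  by exists (h \c h'); rewrite -comp_assoc h1'.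
exact: mmor_nat.
Qed.

Lemma CU_exists X : A X -> C X ->
  exists (CX UX : E) (i : Mor X CX) (p : Mor CX UX), CU i p.
Proof.
move=> AX CX; have [Z0 [U0 [i0 [p0 [BU Si0 versal]]]]] := versal_extension AX CX.
have [T [N' [j [n' [BT CN' Sj]]]]] := proj2 hBC Z0.
(* [T] meets [X] trivially: a map from [B] to [T] that dies in [U0] factors through [X], which lies
   in [C]. *)
have [||W BW g e|U1 [q [BU1 Sq]]] := @B_mono_conf T U0 (p0 \c j).
- exact: iso_closure_self.
- exact: iso_closure_self.
- have [|w ew] := conf_lift hS (h := j \c g) Si0; first by rewrite comp_assoc.
  apply: (conf_mono0 hS Sj).
  by rewrite -ew ((proj1 (hC X) CX) _ BW w) comp0r.
have [N [n [p1 [Sn S1 p1n]]]] := conf_quotient hS Si0 Sq (erefl _).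
have CN : C N.
  have [z hz _] := conf_coker_uniq hS Sn Sj.
  exact: (C_sub hC (iso_mono hz)).
exists N, U1, (n \c i0), p1; split=> // Y BY; apply: (splits_Ext1_eq0 hS).
move=> V i p Sip.
(* [G], the quotient of [V] by [X], is an extension of [Y] by [U1], so versality applies to
   [X -> V -> G] and gives [h]. On [N], the map [n \c h \c i] differs from the identity by a map
   factoring through [U1], which vanishes since [N] lies in [C]; thus [n \c h] retracts [i]. *)
have [G [r [m [q' [Sr Sm _ _]]]]] := inflation_comp_conf hS S1 Sip.
have [|h hh] := versal _ _ _ _ _ Sr.
  by apply: (B_extension hS hAB Sm); apply: iso_closure_self.
have [|w ew] := conf_desc hS (h := n \c h \c i - idm N) S1.
  by rewrite compBl comp_idl -!comp_assoc hh subrr.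
have [|s [ps _ _]] := retraction_section hS (r := n \c h) Sip.
  apply/subr0_eq; rewrite -ew (hom0_C hC w _ CN) ?comp0l //.
  exact: iso_closure_self.
by exists s.
Qed.

Lemma CU_extend X CX UX (i : Mor X CX) (p : Mor CX UX) Y V (a : Mor X V)
    (d : Mor V Y) :
  CU i p -> B' Y -> S a d -> exists h : Mor V CX, h \c a = i.
Proof.
move=> [_ _ _ h0] [Y0 BY [e he]] Sad.
exact: (Ext1_extend hS i (h0 _ BY) (conf_isor hS Sad he)).
Qed.

(** The difference from the identity factors through a map from [B] to [C]. This forces the
    comparison maps of two such sequences to be mutually inverse. *)
Lemma CU_id X CX UX (i : Mor X CX) (p : Mor CX UX) (f : Mor CX CX) :
  CU i p -> f \c i = i -> f = idm CX.
Proof.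
move=> [Sip BU CC _] fi; apply/subr0_eq.
have [|w <-] := conf_desc hS (h := f - idm CX) Sip.
  by rewrite compBl fi comp_idl subrr.
by rewrite (hom0_C hC w (iso_closure_self BU) CC) comp0l.
Qed.

Lemma CU_unique X CX UX CX' UX' (i : Mor X CX) (p : Mor CX UX)
    (i' : Mor X CX') (p' : Mor CX' UX') :
  CU i p -> CU i' p' -> exists (c : Mor CX CX') (u : Mor UX UX'),
    [/\ is_iso c, is_iso u, c \c i = i' & u \c p = p' \c c].
Proof.
move=> h h'; have [Sp BU _ _] := h; have [Sp' BU' _ _] := h'.
have [c ci] := CU_extend h' (iso_closure_self BU) Sp.
have [c' ci'] := CU_extend h (iso_closure_self BU') Sp'.
have c'c : c' \c c = idm CX by apply: (CU_id h); rewrite -comp_assoc ci.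
have cc' : c \c c' = idm CX' by apply: (CU_id h'); rewrite -comp_assoc ci'.
have [|u up] := conf_desc hS (h := p' \c c) Sp.
  by rewrite -comp_assoc ci (conf0 hS Sp').
have [|u' up'] := conf_desc hS (h := p \c c') Sp'.
  by rewrite -comp_assoc ci' (conf0 hS Sp).
exists c, u; split=> //; first by exists c'.
exists u'; split.
  apply: (conf_epi hS Sp).
  by rewrite -comp_assoc up comp_assoc up' -comp_assoc c'c comp_idl comp_idr.
apply: (conf_epi hS Sp').
by rewrite -comp_assoc up' comp_assoc up -comp_assoc cc' comp_idl comp_idr.
Qed.

(** * The unit of the reflection onto [B] *)

Definition eta X : Mor X (L X) := adj hF (idm (F X)).

Lemma eta_nat X X' (f : Mor X X') : fmap L f \c eta X = eta X' \c f.
Proof.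
have := adj_nat hF f (idm (F X')) (idm (F X')).
have := adj_nat hF (idm X) (idm (F X)) (fmap F f).
rewrite !comp_idl !comp_idr fmap_id !comp_idr /= => <- ->.
by [].
Qed.

Lemma adj_eta X (Y : full_sub B) (u : Mor (F X) Y) :
  adj hF u = (u : @Mor E (L X) (sval Y)) \c eta X.
Proof.
have := adj_nat hF (idm X) (idm (F X)) u.
by rewrite !comp_idr fmap_id comp_idr.
Qed.

Lemma eta_desc X Y (f : Mor X Y) : B Y -> exists u : Mor (L X) Y, u \c eta X = f.
Proof.
move=> BY; have [g _ fg] := adj_bij hF X (exist _ Y BY).
by exists (g f); apply: etrans (fg f); apply/esym/adj_eta.
Qed.

Lemma eta_epi X Y (u v : Mor (L X) Y) :
  B Y -> u \c eta X = v \c eta X -> u = v.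
Proof.
move=> BY e; apply: (bij_inj (adj_bij hF X (exist _ Y BY))).
by rewrite [LHS]adj_eta [RHS]adj_eta.
Qed.

Lemma B_L X : B (L X).
Proof. exact: (proj2_sig (F X)). Qed.

(** The [B]-term of the torsion sequence and [L X] are both reflections of [X] in [B], hence
    isomorphic under [X]. *)
Lemma eta_conf X : exists K (k : Mor K X), A K /\ S k (eta X).
Proof.
have [K [Y [k [p [AK BY Skp]]]]] := proj2 hAB X.
exists K, k; split=> //; have [u up] := eta_desc p BY.
have [|v vp] := conf_desc hS (h := eta X) Skp.
  exact: (proj1 hAB _ _ AK (B_L X)).
rewrite -vp; apply: (conf_isor hS Skp); exists u; split.
  by apply: (conf_epi hS Skp); rewrite -comp_assoc vp up comp_idl.
by apply: (eta_epi (B_L X)); rewrite -comp_assoc up vp comp_idl.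
Qed.

Lemma eta_iso K X Y (k : Mor K X) (d : Mor X Y) :
  S k d -> A' K -> B' Y -> exists2 z : Mor (L X) Y, is_iso z & z \c eta X = d.
Proof.
move=> Skd AK BY; have [K' [k' [AK' Sk']]] := eta_conf X.
have [|v vd] := conf_desc hS (h := eta X) Skd; first exact: AK (B_L X) _.
have [|u ud] := conf_desc hS (h := d) Sk'.
  exact: (perp_left_hom0 _ (torsion_perp_left hAB AK')).
exists u => //; exists v; split.
  by apply: (conf_epi hS Sk'); rewrite -comp_assoc ud vd comp_idl.
by apply: (conf_epi hS Skd); rewrite -comp_assoc vd ud comp_idl.
Qed.

(** * The objects of [D] as the image of [C] *)

Notation D := (D_sub S A B C).

Lemma C_embed X : C X ->
  exists X0 CX U (i : Mor X0 CX) (p : Mor CX U) Q (u : Mor (L X) U) (q : Mor U Q),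
    [/\ A X0, C X0, CU i p, B Q & S u q].
Proof.
move=> CX; have [K [k [AK Sk]]] := eta_conf X.
have CK : C K := C_sub hC (conf_mono hS Sk) CX.
have [CK' [U [i [p hCU]]]] := CU_exists AK CK.
have [Si BU _ _] := hCU.
have [h hk] := CU_extend hCU (iso_closure_self (B_L X)) Sk.
have [|u uh] := conf_desc hS (h := p \c h) Sk.
  by rewrite -comp_assoc hk (conf0 hS Si).
have [|||Q [q [BQ Sq]]] := @B_mono_conf (L X) U u.
- exact: iso_closure_self (B_L X).
- exact: iso_closure_self.
- move=> W BW g ug.
  (* [X] is the pullback of [CK'] along [u], so a map killed by [u] lifts to [X] and vanishes
     there. *)
  have [_ /(_ W 0 g)] := conf_mor_pullback hS Sk Si hk (esym uh).
  rewrite comp0r ug => /(_ erefl) [w [[_ <-] _]].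
  by rewrite ((proj1 (hC X) CX) _ BW w) comp0r.
by exists K, CK', U, i, p, Q, u, q.
Qed.

Lemma C_D X : C X -> D (L X).
Proof.
move=> /C_embed [X0 [CX [U [i [p [Q [u [q [AX0 CX0 hCU BQ Su]]]]]]]]].
apply: (@Sub_cl_inflation _ _ _ _ _ u); first by exists Q, q.
by apply: Sub_cl_gen; exists X0; split=> //; exists CX, i, p.
Qed.

(** By [eta_iso] such a [Y] is isomorphic to [L X]. In this form, lying in the image of [C] passes
    to sums and admissible subobjects, hence to all of [D]. *)
Definition covered Y :=
  B' Y /\ exists X K (k : Mor K X) (d : Mor X Y), [/\ C X, A' K & S k d].

Lemma covered_sum Y1 Y2 (b : biproduct Y1 Y2) :
  covered Y1 -> covered Y2 -> covered b.
Proof.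
move=> [BY1 [X1 [K1 [k1 [d1 [CX1 AK1 Sk1]]]]]].
move=> [BY2 [X2 [K2 [k2 [d2 [CX2 AK2 Sk2]]]]]].
split; first exact: (B_extension hS hAB (biproduct_conf hS b)).
(* [X] is the sum of [X1] and [X2], built by two pullbacks so as to come with a deflation onto [b]
   whose kernel is an extension of [K2] by [K1]. *)
have [Q [k2' [d2' [b2 [Sk2' e2 _ pb2]]]]] := pullback_conf hS (bp_pr2 b) Sk2.
have [X [k1' [d1' [b1 [Sk1' e1 _ pb1]]]]] :=
  pullback_conf hS (bp_pr1 b \c d2') Sk1.
have [K [n [m [t [Sn Sm _ _]]]]] := deflation_comp_conf hS Sk1' Sk2'.
exists X, K, n, (d2' \c d1'); split=> //; last first.
  exact: (perp_left_extension hS Sm).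
apply/hC => W BW f; have hom0 := hom0_C hC _ (iso_closure_self BW).
apply: (pullback_eq pb1); rewrite comp0r; first exact: hom0.
apply: (pullback_eq pb2); rewrite comp0r; first exact: hom0.
apply: (biprod_ext (b := b)); rewrite comp0r !comp_assoc.
  by rewrite -e1 -comp_assoc (hom0 _ (b1 \c f) CX1) comp0r.
by rewrite -e2 -!comp_assoc (hom0 _ (b2 \c (d1' \c f)) CX2) comp0r.
Qed.

(** The pullback of [X] along [i] has the same kernel [K], and it lies in [C] as a subobject of
    [X]. *)
Lemma covered_inflation Y' Y (i : Mor Y' Y) :
  inflation S i -> covered Y -> covered Y'.
Proof.
move=> [Z [p Si]] [BY [X [K [k [d [CX AK Sk]]]]]].
split; first exact: (B_sub hS hAB (conf_mono hS Si)).
have [X' [k' [d' [b [Sk' e bk _]]]]] := pullback_conf hS i Sk.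
exists X', K, k', d'; split=> //; apply: (C_sub hC _ CX).
exact: (conf_mono hS (pullback_inflation hS Sk' Sk bk e Si)).
Qed.

Lemma D_covered Y : D Y -> covered Y.
Proof.
elim=> [{}Y [X [AX CX [CX' [i [p [Si BY CCX' _]]]]]]|Y1 Y2 b _ h1 _ h2|Y' Z i hi _].
- split; first exact: iso_closure_self.
  by exists CX', X, i, p; split=> //; exact: (torsion_perp_left hAB).
- exact: covered_sum.
exact: covered_inflation hi.
Qed.

Lemma D_B Y : D Y -> B' Y.
Proof. by move=> /D_covered []. Qed.

Lemma D_lift Y : D Y -> exists2 X, C X & isomorphic (L X) Y.
Proof.
move=> /D_covered [BY [X [K [k [d [CX AK Sk]]]]]].
by exists X => //; have [z hz _] := eta_iso Sk AK BY; exists z.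
Qed.

Lemma D_embed Y : D Y ->
  exists X0 CX U (i : Mor X0 CX) (p : Mor CX U) Q (u : Mor Y U) (q : Mor U Q),
    [/\ A X0, C X0, CU i p, B Q & S u q].
Proof.
move=> /D_lift [X /C_embed [X0 [CX [U [i [p [Q [u [q [? ? ? ? Su]]]]]]]]]].
move=> /isomorphic_sym [z hz].
by exists X0, CX, U, i, p, Q, (u \c z), q; split=> //; apply: conf_isol.
Qed.

Lemma zero_D : exists2 O, zero_object O & D O.
Proof.
have [[Z hZ] _] := exact_additive hS.
(* [A] is not assumed closed under isomorphism; its zero object is found as the torsion part of
   [Z]. *)
have [O [Y [i [p [AO BY Si]]]]] := proj2 hAB Z.
have hO : zero_object O.
  have h X (f : Mor X O) : f = 0.
    by apply: (conf_mono hS Si); apply: zero_mor_uniq.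
  by move=> X; split=> // f; rewrite -(comp_idr f) (h _ (idm O)) comp0r.
have CO : C O by apply/hC => W _ f; apply: zero_mor_uniq.
exists O => //; have [CX [U [j [q hCU]]]] := CU_exists AO CO.
apply: (@Sub_cl_inflation _ _ _ _ U 0).
  by exists U, (idm U); apply: (zero_kernel_conf hS hO); apply: is_iso_id.
by apply: Sub_cl_gen; exists O; split=> //; exists CX, j, q.
Qed.

Lemma C_D_dense (h : forall X, C X -> D (L X)) : dense (restrict h).
Proof.
by move=> [Y DY]; have [X CX e] := D_lift DY; exists (exist _ X CX).
Qed.

(** * Injectivity of [U^A] and extensions in [D] *)

Section Injectivity.
Hypothesis hExt2 : forall X Y, B X -> A Y -> C Y -> Ext2_eq0 S X Y.

Lemma CU_injective X CX U (i : Mor X CX) (p : Mor CX U) Y Z W (m : Mor Y Z)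
    (q : Mor Z W) (f : Mor Y U) :
  A X -> C X -> CU i p -> S m q -> B' Z -> B' W -> exists g, g \c m = f.
Proof.
move=> AX CCX hCU Sm BZ [W0 BW [e he]]; have [Si BU CC _] := hCU.
(* The extension [P] of [Y] by [X] classified by [f] is prolonged to an extension [V] of [Z]; the
   map [V -> CX] under [X] then induces [g] on the quotients. *)
have [P [a [d [b [Sa e1 ba _]]]]] := pullback_conf hS f Si.
have [V [a' [d' [v [Sa' va dv]]]]] :=
  Ext2_lift hS (hExt2 BW AX CCX) Sa (conf_isor hS Sm he).
have [h ha] := CU_extend hCU BZ Sa'.
have [|g gd] := conf_desc hS (h := p \c h) Sa'.
  by rewrite -comp_assoc ha (conf0 hS Si).
(* Both maps agree on [X], so they differ by a map from [Y] to [CX], that is, from [B] to [C]. *)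
have hv : h \c v = b.
  have [|w ew] := conf_desc hS (h := h \c v - b) Sa.
    by rewrite compBl -comp_assoc va ha ba subrr.
  apply/subr0_eq; rewrite -ew (hom0_C hC w _ CC) ?comp0l //.
  exact: (B_sub hS hAB (conf_mono hS Sm)).
exists g; apply: (conf_epi hS Sa).
by rewrite -comp_assoc -dv comp_assoc gd -comp_assoc hv e1.
Qed.

Lemma D_extension_closed : extension_closed S D.
Proof.
move=> Y1 Y Y2 i p Si DY1 DY2.
have BY : B' Y := B_extension hS hAB Si (D_B DY1) (D_B DY2).
have [X1 [CX1 [U1 [i1 [p1 [Q1 [u1 [q1 [A1 C1 h1 BQ1 Su1]]]]]]]]] := D_embed DY1.
have [X2 [CX2 [U2 [i2 [p2 [Q2 [u2 [q2 [A2 C2 h2 BQ2 Su2]]]]]]]]] := D_embed DY2.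
have [g gi] := CU_injective u1 A1 C1 h1 Si BY (D_B DY2).
have [_ /(_ U1 U2) [b]] := exact_additive hS.
have [_ BU1 _ _] := h1; have [_ BU2 _ _] := h2.
(* The map of [Y] into the sum of [U1] and [U2] has components an extension [g] of [u1] and
   [u2 \c p]: what the second kills comes from [Y1], where the first is monic. *)
have [|W BW w|Q [q [BQ Sq]]] :=
    @B_mono_conf Y b (bp_in1 b \c g + bp_in2 b \c (u2 \c p)) BY.
- by apply: (B_extension hS hAB (biproduct_conf hS b)); apply: iso_closure_self.
- move=> /[dup] /(congr1 (mcomp (bp_pr1 b))) e1 /(congr1 (mcomp (bp_pr2 b))) e2.
  rewrite comp_assoc comp_addr !comp_assoc bp_11 bp_12 !comp0l addr0 in e1.
  rewrite comp_idl comp0r in e1.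
  rewrite comp_assoc comp_addr !comp_assoc bp_22 bp_21 !comp0l add0r in e2.
  rewrite comp_idl comp0r -comp_assoc in e2.
  have [w' ew'] := conf_lift hS Si (conf_mono0 hS Su2 e2).
  rewrite -ew' comp_assoc gi in e1.
  by rewrite -ew' (conf_mono0 hS Su1 e1) comp0r.
apply: (@Sub_cl_inflation _ _ _ _ b (bp_in1 b \c g + bp_in2 b \c (u2 \c p))).
  by exists Q, q.
apply: Sub_cl_sum; apply: Sub_cl_gen.
  by exists X1; split=> //; exists CX1, i1, p1.
by exists X2; split=> //; exists CX2, i2, p2.
Qed.

Lemma D_exact : exact_category (@sub_class E S D).
Proof.
have [O hO DO] := zero_D.
exact: (extension_closed_exact hS D_extension_closed hO DO).
Qed.

Lemma U_injective X U (BU : B U) :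
  A X -> C X -> is_U S B C X U ->
  injective_object (exist B U BU : full_sub B).
Proof.
move=> AX CX [CX' [i [p hCU]]] [Y BY] [Z BZ] m mm f.
have [[W BW] [q Sq]] := B_literal_mono_conf mm.
exact: (CU_injective f AX CX hCU Sq (iso_closure_self BZ) (iso_closure_self BW)).
Qed.

End Injectivity.

(** * Fullness, kernel and exactness of [F] on [C] *)

Section Quotient.
Hypothesis hE2 : forall X, C X -> in_E2 S A X.
Hypothesis hproj : forall X, A X -> projective_object S X.

Lemma L_full X X' (g : Mor (L X) (L X')) : C X -> exists f, fmap L f = g.
Proof.
move=> CX; have [K [k [AK Sk]]] := eta_conf X'.
have [f ef] := Ext1_lift hS (g \c eta X) (proj1 (hE2 CX AK)) Sk.
by exists f; apply: (eta_epi (B_L X')); rewrite eta_nat ef.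
Qed.

Lemma L_kernel X X' (f : Mor X X') : fmap L f = 0 <-> factors_through A f.
Proof.
split=> [f0|[Z [u [v [AZ ->]]]]].
  have [K [k [AK Sk]]] := eta_conf X'.
  have [|u <-] := conf_lift hS (h := f) Sk; first by rewrite -eta_nat f0 comp0l.
  by exists K, u, k.
apply: (eta_epi (B_L X')); rewrite eta_nat comp0l comp_assoc.
by rewrite (proj1 hAB _ _ AZ (B_L X') (eta X' \c v)) comp0l.
Qed.

(* The point is that [L i] is monic.  As [KZ] is projective, [s] splits
   [t : KY -> KZ]; what [t] kills factors through the idempotent [1 - s t], which
   factors through [X], and maps from [KY] to [L X] vanish. *)
Lemma L_exact X Y Z (i : Mor X Y) (p : Mor Y Z) :
  S i p -> S (fmap L i) (fmap L p).
Proof.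
move=> Si.
have AB0 K W (f : Mor K (L W)) : A K -> f = 0.
  by move=> AK; apply: (proj1 hAB) AK (B_L W) f.
have [KX [kX [AKX SX]]] := eta_conf X.
have [KY [kY [AKY SY]]] := eta_conf Y.
have [KZ [kZ [AKZ SZ]]] := eta_conf Z.
have [|||Q [q [BQ Sq]]] := @B_mono_conf (L X) (L Y) (fmap L i).
- exact: iso_closure_self (B_L X).
- exact: iso_closure_self (B_L Y).
- move=> W BW g ig.
  have [P [a [d [b [Sa e _ _]]]]] := pullback_conf hS g SX.
  have [|c kc] := conf_lift hS (h := i \c b) SY.
    by rewrite comp_assoc -eta_nat -comp_assoc e comp_assoc ig comp0l.
  have [|s0 ps0] := hproj AKZ (p := p) _ kZ; first by exists X, i.
  have [|s ks] := conf_lift hS (h := s0) SY; first exact: AB0.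
  have [|t kt] := conf_lift hS (h := p \c kY) SZ; first exact: AB0.
  have [|l il] := conf_lift hS (h := kY \c (idm KY - s \c t)) Si.
    rewrite compBr comp_idr (comp_assoc kY) ks compBr (comp_assoc p s0) ps0 kt.
    by rewrite subrr.
  have tc : t \c c = 0.
    apply: (conf_mono0 hS SZ).
    by rewrite comp_assoc kt -comp_assoc kc comp_assoc (conf0 hS Si) comp0l.
  have eb : b = l \c c.
    apply: (conf_mono hS Si); rewrite comp_assoc il -comp_assoc compBl.
    by rewrite comp_idl -comp_assoc tc comp0r subr0.
  apply: (conf_epi0 hS Sa).
  by rewrite -e eb comp_assoc (AB0 _ _ (eta X \c l)) // comp0l.
(* [q] and [fmap L p] are both universal among maps from [L Y] to [B] killing [fmap L i], so they
   agree up to isomorphism. *)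
have Lpi : fmap L p \c fmap L i = 0 by rewrite -fmap_comp (conf0 hS Si) fmap0.
have [w wq] := conf_desc hS Sq Lpi.
have [|v vp] := conf_desc hS (h := q \c eta Y) Si.
  by rewrite -comp_assoc -eta_nat comp_assoc (conf0 hS Sq) comp0l.
have [v' ev'] := eta_desc v BQ.
have vLp : v' \c fmap L p = q.
  by apply: (eta_epi BQ); rewrite -comp_assoc eta_nat comp_assoc ev'.
rewrite -wq; apply: (conf_isor hS Sq); exists v'; split.
  by apply: (conf_epi hS Sq); rewrite -comp_assoc wq vLp comp_idl.
apply: (eta_epi (B_L Z)); apply: (conf_epi hS Si).
rewrite -!comp_assoc (comp_assoc v') ev' vp comp_assoc wq eta_nat.
by rewrite comp_idl.
Qed.

Lemma L_lift_conf X1 X3 Y (i : Mor (L X1) Y) (p : Mor Y (L X3)) :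
  C X1 -> C X3 -> S i p -> exists X2 (i' : Mor X1 X2) (p' : Mor X2 X3),
    [/\ C X2, S i' p' & exists2 z : Mor (L X2) Y, is_iso z &
        z \c fmap L i' = i /\ p \c z = fmap L p'].
Proof.
move=> CX1 CX3 Si.
have [K1 [k1 [AK1 S1]]] := eta_conf X1.
have [K3 [k3 [AK3 S3]]] := eta_conf X3.
(* With [K1 -> X1 -> L X1], the pullback [L X1 -> P -> X3] forms a two-extension of [X3] by [K1];
   its lift is [X2]. *)
have [P [j [t [b [Sj e bj pb]]]]] := pullback_conf hS (eta X3) Si.
have [k Sk _] := is_pullback_conf hS (is_pullback_sym pb) S3.
have [X2 [a [d [v [Sa va dv]]]]] :=
  Ext2_lift hS (proj2 (hE2 CX3 AK1)) S1 Sj.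
have Sv := pullback_inflation hS S1 Sa va dv Sj.
(* The kernel [N] of [X2 -> P -> Y] is an extension of [K3] by [K1], so [Y] is the reflection of
   [X2]. *)
have [N [n [m [u [Sn Sm _ _]]]]] := deflation_comp_conf hS Sa Sk.
have AN : A' N.
  by apply: (perp_left_extension hS Sm); apply: (torsion_perp_left hAB).
have BY : B' Y.
  by apply: (B_extension hS hAB Si); apply/iso_closure_self/B_L.
have [z hz ez] := eta_iso Sn AN BY.
exists X2, v, (t \c d); split=> //; first exact: (C_extension hS hC Sv).
exists z => //; split.
  apply: (conf_epi hS S1).
  by rewrite -comp_assoc eta_nat comp_assoc ez -comp_assoc dv comp_assoc bj.
apply: (eta_epi (B_L X3)).
by rewrite -comp_assoc ez eta_nat !comp_assoc e.
Qed.

End Quotient.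
End Setting.

Theorem theorem4p7 (E : category) (S : pair_class E)
    (hE : exact_category S) (hKS : krull_schmidt E)
    (A B C : E -> Prop)
    (hAB : torsion_pair S A B) (hBC : torsion_pair S B C)
    (hC : forall X, C X <-> (forall Y, B Y -> forall f : Mor Y X, f = 0))
    (F : functor E (full_sub B)) (hF : adjunction F (incl B))
    (hBab : abelian_category (full_sub B))
    (hBcompat : forall (X Y Z : full_sub B) (i : Mor X Y) (p : Mor Y Z),
        ker_coker_pair i p <-> sub_class S i p)
    (hfg : forall X, A X -> C X -> Ext1_finitely_generated S B X) :
  let D := D_sub S A B C in
  (* (a) *)
  (forall X, A X -> C X ->
     (exists (CX UX : E) (i : Mor X CX) (p : Mor CX UX),
        CU_sequence S B C i p) /\
     (forall (CX UX CX' UX' : E) (i : Mor X CX) (p : Mor CX UX)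
        (i' : Mor X CX') (p' : Mor CX' UX'),
        CU_sequence S B C i p -> CU_sequence S B C i' p' ->
        exists (c : Mor CX CX') (u : Mor UX UX'),
          [/\ is_iso c, is_iso u, c \c i = i' & u \c p = p' \c c])) /\
  (* (b) *)
  (exists h : forall X, C X -> D (comp_functor (incl B) F X),
     dense (restrict h)) /\
  ((forall X Y, B X -> A Y -> C Y -> Ext2_eq0 S X Y) ->
   (* (c) *)
   (forall X, A X -> C X -> forall (U : E) (hU : B U), is_U S B C X U ->
      injective_object (exist B U hU : full_sub B)) /\
   (* (d) *)
   (extension_closed S D /\ exact_category (@sub_class E S D)) /\
   (* (e) *)
   ((forall X, C X -> in_E2 S A X) ->
    (forall X, A X -> projective_object S X) ->
    let I := factor_ideal C (torsion_sum_closed hE hAB) in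
    let T := image_class (@sub_class E S C) (quotient_proj I) in
    exact_category T /\
    exists (h : forall X, C X -> D (comp_functor (incl B) F X))
           (hI : kills I (restrict h)),
      exact_equivalence T (@sub_class E S D) (quotient_lift hI))).
Proof.
move=> D; split; last split; last move=> hExt2.
- move=> X AX CX; split; first exact: (CU_exists hE hAB hBC hC hBab hBcompat hfg).
  by move=> *; apply: (CU_unique hE hC).
- exists (C_D hE hAB hBC hC hF hBab hBcompat hfg).
  exact: (C_D_dense hE hAB hC hF).
have exD : exact_category (@sub_class E S D).
  exact: (D_exact hE hAB hBC hC hF hBab hBcompat hfg hExt2).
split; last split.
- move=> X AX CX U BU.
  exact: (U_injective hE hAB hC hBab hBcompat hExt2 AX CX).
- split=> //.
  exact: (D_extension_closed hE hAB hBC hC hF hBab hBcompat hfg hExt2).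
move=> hE2 hproj I T.
pose h := C_D hE hAB hBC hC hF hBab hBcompat hfg.
have hI : kills I (restrict h).
  by move=> [X CX] [Y CY] f /asboolP /(L_kernel hE hAB hF).
pose G := quotient_lift hI.
have Gmk (X Y : full_sub C) (f : Mor X Y) :
    fmap G (fmap (quotient_proj I) f) = fmap (restrict h) f.
  exact: (kills_repr hI).
have G_full (X Y : quotient_cat I) (g : Mor (G X) (G Y)) :
    exists f : Mor X Y, fmap G f = g.
  have [f ef] := L_full hE hAB hF hE2 g (proj2_sig X).
  by exists (fmap (quotient_proj I) f); rewrite Gmk.
have G_faithful (X Y : quotient_cat I) (f : Mor X Y) : fmap G f = 0 -> f = 0.
  move=> /(L_kernel hE hAB hF) hf; rewrite -(qmk_repr f).
  rewrite -[RHS](fmap0 (quotient_proj I)).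
  by apply/qmk_eq; rewrite subr0; apply/asboolP.
have G_dense : dense G := C_D_dense hE hAB hC hF h.
have hT X Y Z (i : @Mor (quotient_cat I) X Y) (p : Mor Y Z) :
    T _ _ _ i p <-> @sub_class E S D _ _ _ (fmap G i) (fmap G p).
  split.
    move=> [X' [Y' [Z' [i' [p' [Si iso_ip]]]]]].
    apply: (exact_iso exD (fmap_iso_pairs G iso_ip)); rewrite !Gmk.
    exact: (L_exact hE hAB hF hBab hBcompat hproj Si).
  move=> SG.
  (* The middle term [X2] of the lifted conflation need not be [Y]; the isomorphism [z] of their
     images comes from an isomorphism [y] in the quotient. *)
  have [X2 [i' [p' [CX2 Si [z hz [e1 e2]]]]]] :=
    L_lift_conf hE hAB hC hF hE2 (proj2_sig X) (proj2_sig Z) SG.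
  pose Y' : full_sub C := exist _ X2 CX2.
  pose i1 : @Mor (full_sub C) X Y' := i'.
  pose p1 : @Mor (full_sub C) Y' Z := p'.
  have [y hy ey] := @full_faithful_iso _ _ G G_full G_faithful Y' Y z hz.
  exists X, Y', Z, i1, p1; split=> //.
  exists (idm _), y, (idm _); split=> //; try exact: is_iso_id.
    apply: (faithful_inj G_faithful); rewrite comp_idr fmap_comp ey Gmk.
    exact: e1.
  apply: (faithful_inj G_faithful); rewrite comp_idl fmap_comp ey Gmk.
  exact: esym e2.
split; first exact: (preimage_exact G_full G_faithful G_dense exD hT).
exists h, hI; split; first exact: full_faithful_dense_equivalence.
exists (preimage_exact_functor hT).
exact: (preimage_Ext1_iso G_full G_faithful G_dense exD hT).
Qed.
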